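(* For every $1\leq p\leq\infty$, $\gamma_{p}$ is a finitely generated tensor norm.
   Context: $X,Y,Z$ denote Banach spaces over $\mathbb{K}$ ($=\mathbb{R}$ or $\mathbb{C}$), $Z^{*}$ the topological dual, $B_Z$ the closed unit ball. $p^{*}$ is the conjugate exponent of $p$ ($1/p+1/p^*=1$). Sequence spaces. For $1\le q<\infty$: $\|(z_j)_j\|_q=(\sum_j\|z_j\|^q)^{1/q}$; $\ell_q^w(Z)$ is the space of sequences with $\|(z_j)_j\|_q^w=\sup_{z^*\in B_{Z^*}}(\sum_j|z^*(z_j)|^q)^{1/q}<\infty$; $\ell_q^{mid}(Z)$ is the space of sequences $(z_j)_j$ in $Z$ such that $\sum_n\sum_j|z_n^*(z_j)|^q<\infty$ for every $(z_n^* )_n\in\ell_q^w(Z^* )$, with norm $\|(z_j)_j\|_q^{mid}=\sup_{(z_n^* )_n\in B_{\ell_q^w(Z^* )}}(\sum_n\sum_j|z_n^*(z_j)|^q)^{1/q}$. For $q=\infty$, $\|\cdot\|_\infty=\|\cdot\|_\infty^{mid}$ is the sup norm on $\ell_\infty(Z)=\ell_\infty^{mid}(Z)$. Finite sequences are regarded as infinite sequences extended by zeros. For Banach spaces $X,Y$ and $u\in X\otimes Y$, $\gamma_p(u)=\inf\{\|(x_j)_{j=1}^n\|_{p^*}^{mid}\,\|(y_j)_{j=1}^n\|_p: u=\sum_{j=1}^n x_j\otimes y_j\}$. A norm $\alpha$ on $X\otimes Y$ is a reasonable cross norm if $\varepsilon(u)\le\alpha(u)\le\pi(u)$ for all $u\in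 X\otimes Y$, where $\varepsilon$, $\pi$ are the injective and projective norms. A tensor norm is a uniform reasonable cross norm: an assignment of a reasonable cross norm $\alpha$ to $X\otimes Y$ for every pair of Banach spaces such that for all Banach spaces $X_1,X_2,Y_1,Y_2$ and bounded linear $S_1:X_1\to Y_1$, $S_2:X_2\to Y_2$ one has $\|S_1\otimes S_2:X_1\otimes_\alpha X_2\to Y_1\otimes_\alpha Y_2\|\le\|S_1\|\|S_2\|$. It is finitely generated if for all Banach spaces $X,Y$ and $u\in X\otimes Y$, $\alpha_{X,Y}(u)=\inf\{\alpha_{M,N}(u): u\in M\otimes N,\ M\subseteq X,\ N\subseteq Y,\ \dim M,\dim N<\infty\}$. *)

(* Defs.v *)
From HB Require Import structures.
From mathcomp Require Import all_boot all_order all_algebra.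
From mathcomp Require Import all_classical all_reals ereal topology.
From mathcomp Require Import normedtype sequences esum exp hoelder.
From mathcomp Require Import sesquilinear.
From mathcomp.real_closed Require Import complex.
Set Implicit Arguments.
Unset Strict Implicit.
Unset Printing Implicit Defensive.
Import Order.TTheory GRing.Theory Num.Theory.
Import numFieldNormedType.Exports.
Local Open Scope classical_set_scope.
Local Open Scope ring_scope.

Variant scalar_kind := RealScalars | ComplexScalars.

Definition scalar_field (R : realType) (k : scalar_kind) : numFieldType :=
  match k with RealScalars => R | ComplexScalars => R[i] end.

(* Norms of normed modules over K take values in K; [scal_re] sends them back to
   R, and [scal_real] is the embedding of R into K. *)
Definition scal_re (R : realType) (k : scalar_kind) : scalar_field R k -> R :=
  match k with RealScalars => id | ComplexScalars => @complex.Re R end.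

Definition scal_real (R : realType) (k : scalar_kind) : R -> scalar_field R k :=
  match k with RealScalars => id | ComplexScalars => real_complex R end.
Arguments scal_real {R} k x.

Section scalar_theory.
Context {R : realType} {k : scalar_kind}.
Local Notation K := (scalar_field R k).
Implicit Types (a b : K) (x y : R).

Lemma scal_reD a b : scal_re (a + b) = scal_re a + scal_re b.
Proof. by case: k a b => //= -[? ?] [? ?]. Qed.

Lemma scal_realK : cancel (@scal_real R k) (@scal_re R k).
Proof. by case: k. Qed.

Lemma scal_realD x y : scal_real k (x + y) = scal_real k x + scal_real k y.
Proof. case: k => //=; exact: (rmorphD (real_complex R)). Qed.

Lemma scal_realM x y : scal_real k (x * y) = scal_real k x * scal_real k y.
Proof. case: k => //=; exact: (rmorphM (real_complex R)). Qed.

Lemma le_scal_real x y : (scal_real k x <= scal_real k y) = (x <= y).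
Proof. by case: k => //=; exact: lecR. Qed.

Lemma scal_real0 : scal_real k (0 : R) = 0.
Proof. by case: k. Qed.

Lemma scal_real1 : scal_real k (1 : R) = 1.
Proof. by case: k. Qed.

Lemma scal_reK a : 0 <= a -> scal_real k (scal_re a) = a.
Proof.
case: k a => //= -[b c]; rewrite (lecE 0 (Complex b c))/=.
by case/andP => /eqP -> _.
Qed.

Lemma scal_real_inj : injective (@scal_real R k).
Proof. exact: can_inj scal_realK. Qed.

Lemma scalar_complete (F : set_system K^o) :
  ProperFilter F -> cauchy F -> cvg F.
Proof.
case: k F => /= F FF; first exact: (@R_complete R F).
move=> /(@cauchyP _ (R[i])^o) Fc.
have cF (g : R[i] -> R) : (forall z w, (`|g z - g w|%:C)%C <= `|z - w|) ->
    cvg (g @ F).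
  move=> gL; apply: R_complete; apply/cauchy_exP => e e0.
  have e0' : 0 < (e%:C)%C :> R[i] by rewrite ltcR.
  have [z Fz] := Fc _ e0'.
  exists (g z); rewrite /fmap/=; apply: filterS Fz => w /= zw.
  have {}zw : `|(z : R[i]) - w| < (e%:C)%C by exact: zw.
  have : `|g z - g w| < e by rewrite -ltcR (le_lt_trans (gL _ _)).
  exact.
have ReL (z w : R[i]) : (`|complex.Re z - complex.Re w|%:C)%C <= `|z - w|.
  by rewrite (le_trans _ (normc_ge_Re _))//; case: z w => [? ?] [? ?].
have ImL (z w : R[i]) : (`|complex.Im z - complex.Im w|%:C)%C <= `|z - w|.
  case: z w => [a b] [c d]; rewrite -[_ - _ in leRHS]/(Complex (a - c) (b - d)).
  by rewrite normc_def/= lecR -sqrtr_sqr ler_wsqrtr// lerDr sqr_ge0.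
have normcD (x y : R) : `|Complex x y| <= ((`|x| + `|y|)%:C)%C.
  rewrite normc_def/= lecR -(@ler_pXn2r _ 2)// ?nnegrE ?sqrtr_ge0 ?addr_ge0//.
  rewrite sqr_sqrtr ?addr_ge0 ?sqr_ge0// sqrrD !real_normK ?num_real//.
  by rewrite lerD2r lerDl mulrn_wge0// mulr_ge0.
have /cvg_ex[a Fa] := cF _ ReL.
have /cvg_ex[b Fb] := cF _ ImL.
apply/cvg_ex; exists (Complex a b).
apply/(@cvgrPdist_lt _ (R[i])^o) => -[e e'].
rewrite (ltcE 0 (Complex e e'))/= => /andP[/eqP -> e0].
have e20 : 0 < e / 2 by rewrite divr_gt0.
have /(@cvgrPdist_lt _ R^o)/(_ _ e20) {}Fa := Fa.
have /(@cvgrPdist_lt _ R^o)/(_ _ e20) {}Fb := Fb.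
rewrite !near_simpl/= in Fa Fb *.
apply: filterS2 Fa Fb => -[c d] /= ac bd.
rewrite -[X in `|X|]/(Complex (a - c) (b - d)).
rewrite (le_lt_trans (normcD _ _))// ltcR [e]splitr ltrD//.
Qed.
End scalar_theory.

Section real_norm.
Context {R : realType} {k : scalar_kind}.
Local Notation K := (scalar_field R k).

Definition nrm (V : normedModType K) (x : V) : R := scal_re `|x|.

Lemma nrmE (V : normedModType K) (x : V) : scal_real k (nrm x) = `|x|.
Proof. exact: scal_reK. Qed.

Context {V : normedModType K}.
Implicit Types (a : K) (x y : V).

Lemma nrm_ge0 x : 0 <= nrm x.
Proof. by rewrite -(@le_scal_real R k) scal_real0 nrmE. Qed.

Lemma nrmD x y : nrm (x + y) <= nrm x + nrm y.
Proof. by rewrite -(@le_scal_real R k) scal_realD !nrmE ler_normD. Qed.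

Lemma nrmZ a x : nrm (a *: x) = nrm (a : K^o) * nrm x.
Proof. by apply: (@scal_real_inj R k); rewrite scal_realM !nrmE normrZ. Qed.

Lemma nrm0_eq0 x : nrm x = 0 -> x = 0.
Proof.
by move=> x0; apply/eqP; rewrite -normr_eq0 -nrmE x0 scal_real0.
Qed.

Lemma nrm0 : nrm (0 : V) = 0.
Proof. by apply: (@scal_real_inj R k); rewrite nrmE normr0 scal_real0. Qed.

Lemma nrm1 : nrm (1 : K^o) = 1.
Proof. by apply: (@scal_real_inj R k); rewrite nrmE normr1 scal_real1. Qed.

Lemma le_nrm x y : (nrm x <= nrm y) = (`|x| <= `|y|).
Proof. by rewrite -(@le_scal_real R k) !nrmE. Qed.

End real_norm.

Section dual.
Context {R : realType} {k : scalar_kind}.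
Local Notation K := (scalar_field R k).
Variable V : normedModType K.

(* The topological dual, normed by the supremum over the closed unit ball. *)
Definition dual_pred : {pred V -> K^o} :=
  fun f => `[< linear f /\ continuous f >].

Lemma dual_pred_closed : subsemimod_closed dual_pred.
Proof.
split; first split.
- apply/asboolP; split=> [a x y|]; first by rewrite /= scaler0 addr0.
  exact: cst_continuous.
- move=> f g /asboolP[fl fc] /asboolP[gl gc]; apply/asboolP; split.
    by move=> a x y; rewrite !addrfctE fl gl scalerDr addrACA.
  by move=> x; apply: cvgD; [exact: fc|exact: gc].
- move=> a f /asboolP[fl fc]; apply/asboolP; split.
    by move=> b x y; rewrite !scalrfctE fl scalerDr !scalerA mulrC.
  by move=> x; apply: cvgZr; exact: fc.
Qed.

HB.instance Definition _ :=
  GRing.isSubmodClosed.Build K (V -> K^o) dual_pred dual_pred_closed.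

Definition dual := {f : V -> K^o | f \in dual_pred}.

HB.instance Definition _ := [isSub of dual for @sval _ _].
HB.instance Definition _ := [Choice of dual by <:].
HB.instance Definition _ := [SubChoice_isSubLmodule of dual by <:].

Definition dual_fun (f : dual) : V -> K^o := val f.
Coercion dual_fun : dual >-> Funclass.

Lemma dual_fun_linear (f : dual) : linear (dual_fun f).
Proof. by have /asboolP[] := valP f. Qed.

HB.instance Definition _ (f : dual) :=
  GRing.isLinear.Build K V K^o *:%R (dual_fun f) (dual_fun_linear f).

Lemma dual_fun_continuous (f : dual) : continuous f.
Proof. by have /asboolP[] := valP f. Qed.

Definition dual_norm (f : dual) : R :=
  sup [set nrm (f x) | x in [set x : V | nrm x <= 1]].

Lemma dual_bounded (f : dual) :
  exists2 M : R, 0 < M & forall x, nrm (f x) <= M * nrm x.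
Proof.
have /linear_bounded_continuous/linear_boundedP := @dual_fun_continuous f.
move=> /pinfty_ex_gt0[r r0 fr]; have r0' := ltW r0; exists (scal_re r) => [|x].
  rewrite lt_neqAle -(@le_scal_real R k) scal_real0 scal_reK// r0' andbT.
  apply: contraTneq r0 => r0.
  by rewrite -(scal_reK r0') -r0 scal_real0 ltxx.
by rewrite -(@le_scal_real R k) scal_realM scal_reK// !nrmE; exact: fr.
Qed.

Lemma dual_norm_has_sup (f : dual) :
  has_sup [set nrm (f x) | x in [set x : V | nrm x <= 1]].
Proof.
split; first by exists (nrm (f 0)), 0 => //=; rewrite nrm0.
have [M M0 fM] := dual_bounded f.
exists M => _ [x /= x1 <-]; apply: le_trans (fM x) _.
by rewrite ler_piMr// ltW.
Qed.

Lemma dual_norm_ge (f : dual) (x : V) : nrm x <= 1 -> nrm (f x) <= dual_norm f.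
Proof.
by move=> x1; apply: ub_le_sup; [exact: (dual_norm_has_sup f).2|exists x].
Qed.

Lemma dual_norm_ge0 (f : dual) : 0 <= dual_norm f.
Proof. by rewrite (le_trans _ (@dual_norm_ge f 0 _)) ?nrm_ge0 ?nrm0. Qed.

Lemma dual_norm_le (f : dual) (M : R) :
  (forall x, nrm x <= 1 -> nrm (f x) <= M) -> dual_norm f <= M.
Proof.
move=> fM; apply: ge_sup; first exact: (dual_norm_has_sup f).1.
by move=> _ [x /= x1 <-]; exact: fM.
Qed.

Lemma dual_normD (f g : dual) : dual_norm (f + g) <= dual_norm f + dual_norm g.
Proof.
apply: dual_norm_le => x x1.
by rewrite (le_trans (nrmD (f x) (g x)))// lerD// dual_norm_ge.
Qed.

Lemma dual_normZ_le (a : K) (f : dual) :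
  dual_norm (a *: f) <= nrm (a : K^o) * dual_norm f.
Proof.
apply: dual_norm_le => x x1; rewrite [X in nrm X](_ : _ = a *: f x)//.
by rewrite nrmZ ler_wpM2l ?nrm_ge0// dual_norm_ge.
Qed.

Lemma dual_normZ (a : K) (f : dual) :
  dual_norm (a *: f) = nrm (a : K^o) * dual_norm f.
Proof.
have [->|a0] := eqVneq a 0.
  rewrite scale0r nrm0 mul0r; apply/eqP; rewrite eq_le dual_norm_ge0 andbT.
  by have := dual_normZ_le 0 0; rewrite scale0r nrm0 mul0r.
apply/eqP; rewrite eq_le dual_normZ_le/=.
have na0 : nrm (a : K^o) != 0 by apply: contra_neq a0 => /nrm0_eq0.
have nVa : nrm (a^-1 : K^o) = (nrm (a : K^o))^-1.
  by apply: (mulfI na0); rewrite -nrmZ /GRing.scale/= !divff// nrm1.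
rewrite -ler_pdivlMl ?lt_neqAle 1?eq_sym ?na0 ?nrm_ge0// -nVa.
by rewrite -[f in leLHS](scalerK a0) dual_normZ_le.
Qed.

Lemma dual_norm_eq0 (f : dual) : dual_norm f = 0 -> f = 0.
Proof.
move=> f0; apply: val_inj; apply: funext => x; rewrite -[LHS]/(f x) -[RHS]/(0 : K^o).
have [->|x0] := eqVneq x 0; first by rewrite linear0.
have nx0 : `|x| != 0 by rewrite normr_eq0.
have nVx0 : `|x|^-1 != 0 by rewrite invr_eq0.
apply: (scalerI nVx0).
rewrite scaler0 -linearZ_LR; apply: nrm0_eq0; apply/eqP.
rewrite eq_le nrm_ge0 andbT -f0 dual_norm_ge//.
by rewrite -(@le_scal_real R k) nrmE normfZV// scal_real1.
Qed.

Lemma dual_norm_scalD (f g : dual) :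
  scal_real k (dual_norm (f + g)) <=
  scal_real k (dual_norm f) + scal_real k (dual_norm g).
Proof. by rewrite -scal_realD le_scal_real dual_normD. Qed.

Lemma dual_norm_scalZ (a : K) (f : dual) :
  scal_real k (dual_norm (a *: f)) = `|a| * scal_real k (dual_norm f).
Proof. by rewrite dual_normZ scal_realM nrmE. Qed.

Lemma dual_norm_scal_eq0 (f : dual) : scal_real k (dual_norm f) = 0 -> f = 0.
Proof.
by rewrite -(@scal_real0 R k) => /scal_real_inj; exact: dual_norm_eq0.
Qed.

HB.instance Definition _ := Lmodule_isNormed.Build K dual
  dual_norm_scalD dual_norm_scalZ dual_norm_scal_eq0.

Lemma nrm_dual (f : dual) : nrm f = dual_norm f.
Proof. exact: scal_realK. Qed.

End dual.

Section span.
Context {R : realType} {k : scalar_kind}.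
Local Notation K := (scalar_field R k).
Context {V : normedModType K}.
Implicit Types (s : seq V).

Definition span s : set V :=
  [set x | exists c : nat -> K, x = \sum_(i < size s) c i *: s`_i].

Lemma span_lin s (a : K) x y : span s x -> span s y -> span s (a *: x + y).
Proof.
move=> [c ->] [d ->]; exists (fun i => a * c i + d i).
rewrite scaler_sumr -big_split/=; apply: eq_bigr => i _.
by rewrite scalerDl scalerA.
Qed.

Lemma span0 s : span s 0.
Proof.
by exists (fun=> 0); rewrite big1// => i _; rewrite scale0r.
Qed.

Lemma spanZ s (a : K) x : span s x -> span s (a *: x).
Proof. by move=> sx; rewrite -[_ *: _]addr0; exact: span_lin (span0 s). Qed.

Lemma spanB s x y : span s x -> span s y -> span s (x - y).
Proof. by move=> sx sy; rewrite addrC -scaleN1r; exact: span_lin. Qed.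

Lemma span_cons y s x :
  span (y :: s) x <-> exists a : K, span s (x - a *: y).
Proof.
split=> [[c ->]|[a [c xay]]].
  exists (c 0%N), (fun i => c i.+1).
  by rewrite big_ord_recl/= addrAC subrr add0r.
exists (fun i => if i is j.+1 then c j else a).
by rewrite big_ord_recl/= -xay addrC subrK.
Qed.

Lemma span_closed s : closed (span s).
Proof.
elim: s => [|y s IH].
  rewrite (_ : span [::] = [set 0]); last first.
    apply/seteqP; split=> [_ [c ->]|_ ->]; first by rewrite big_ord0.
    exact: span0.
  exact/accessible_closed_set1/hausdorff_accessible/norm_hausdorff.
have [ys|yNs] := pselect (span s y).
  rewrite (_ : span (y :: s) = span s)//; apply/seteqP; split=> x.
    move=> /span_cons[a xs]; rewrite -(subrK (a *: y) x) addrC.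
    exact: span_lin.
  move=> xs; apply/span_cons; exists 0.
  by rewrite scale0r subr0.
have [d d0 dy] : exists2 d : K, 0 < d & forall m, span s m -> d <= `|y - m|.
  have : (~` span s) y by [].
  have /open_nbhs_nbhs : open_nbhs y (~` span s) by split => //; exact: closed_openC.
  move=> /nbhs_normP[d/= d0 dy] _; exists d => // m sm.
  rewrite real_leNgt ?normr_real ?gtr0_real//; apply/negP => ym.
  exact: (dy m).
have dist (a : K) m : span s m -> `|a| * d <= `|a *: y + m|.
  move=> sm; have [->|a0] := eqVneq a 0; first by rewrite normr0 mul0r.
  rewrite -[m](scalerKV a0) -scalerDr normrZ ler_wpM2l// -[_ *: m]opprK dy//.
  by rewrite -scaleNr; exact: spanZ.
have cof w : {a : K | span (y :: s) w -> span s (w - a *: y)}.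
  apply: cid; have [/span_cons[a wa]|nw] := pselect (span (y :: s) w).
    by exists a.
  by exists 0.
pose c w : K^o := projT1 (cof w).
have cP w : span (y :: s) w -> span s (w - c w *: y) by exact: (projT2 (cof w)).
move=> x xcl.
pose F := within (span (y :: s)) (nbhs x).
have FF : ProperFilter F.
  split; last exact: within_filter.
  move=> F0; have [z [zs]] := xcl _ F0; exact.
have Fs : F (span (y :: s)) by exact: withinT.
have Fx : F --> x by apply: cvg_within.
have Fc : cauchy (c @ F).
  apply/(@cauchy_exP _ K^o) => e e0.
  have : \forall z \near F, `|x - z| < e * d / 2.
    by apply: (@cvgrPdist_lt _ _ _ F _ id x).1 => //; rewrite divr_gt0 ?mulr_gt0.
  move=> H; have [z [zs zx]] := filter_ex (filterI Fs H).
  exists (c z); rewrite /fmap/=; apply: filterS2 Fs H => w ws wx.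
  rewrite -ball_normE/= -(ltr_pM2r d0).
  have := dist (c z - c w) _ (spanB (cP _ zs) (cP _ ws)).
  rewrite (_ : _ *: y + _ = z - w); last first.
    rewrite scalerBl -[in RHS](subrK (c z *: y) z) -[in RHS](subrK (c w *: y) w).
    by rewrite [in RHS]opprD [RHS]addrACA addrC.
  move=> /le_lt_trans; apply.
  rewrite (le_lt_trans (ler_distD x _ _))// [e * d]splitr ltrD//.
  by rewrite distrC.
have ca : c @ F --> lim (c @ F) by exact: scalar_complete _ Fc.
apply/span_cons; exists (lim (c @ F)).
apply: (@closed_cvg _ _ F _ (fun w => w - c w *: y)) => //.
  exact: filterS Fs.
by apply: cvgB => //; apply: cvgZl.
Qed.

End span.

Section fd_subspace.
Context {R : realType} {k : scalar_kind}.
Local Notation K := (scalar_field R k).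

(* The finite-dimensional subspaces of X are the spans of its finite families;
   [fd_carrier] equips such a subspace with the norm induced by X. *)
Record fd_subspace (X : completeNormedModType K) := FdSubspace {
  fd_set : set X;
  fd_setP : exists s : seq X, fd_set = span s }.

Variables (X : completeNormedModType K) (M : fd_subspace X).

Definition fd_pred : {pred X} := fun x => `[< fd_set M x >].

Lemma fd_pred_closed : subsemimod_closed fd_pred.
Proof.
rewrite /fd_pred; have [s ->] := fd_setP M; split; first split.
- exact/asboolP/span0.
- move=> x y /asboolP sx /asboolP sy; apply/asboolP.
  by rewrite -[x]scale1r; exact: span_lin.
- by move=> a x /asboolP sx; apply/asboolP; exact: spanZ.
Qed.

HB.instance Definition _ :=
  GRing.isSubmodClosed.Build K X fd_pred fd_pred_closed.

Definition fd_carrier := {x : X | x \in fd_pred}.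

HB.instance Definition _ := [isSub of fd_carrier for @sval _ _].
HB.instance Definition _ := [Choice of fd_carrier by <:].
HB.instance Definition _ := [SubChoice_isSubLmodule of fd_carrier by <:].

Definition fd_incl (x : fd_carrier) : X := val x.

Lemma fd_incl_linear : linear fd_incl.
Proof. by []. Qed.

HB.instance Definition _ :=
  GRing.isLinear.Build K fd_carrier X *:%R fd_incl fd_incl_linear.

Lemma fd_normD (x y : fd_carrier) :
  `|fd_incl (x + y)| <= `|fd_incl x| + `|fd_incl y|.
Proof. by rewrite linearD ler_normD. Qed.

Lemma fd_normZ (a : K) (x : fd_carrier) :
  `|fd_incl (a *: x)| = `|a| * `|fd_incl x|.
Proof. by rewrite linearZ_LR normrZ. Qed.

Lemma fd_norm_eq0 (x : fd_carrier) : `|fd_incl x| = 0 -> x = 0.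
Proof. by move=> /normr0_eq0 x0; exact: val_inj. Qed.

HB.instance Definition _ := Lmodule_isNormed.Build K fd_carrier
  fd_normD fd_normZ fd_norm_eq0.

Lemma fd_complete (F : set_system fd_carrier) :
  ProperFilter F -> cauchy F -> cvg F.
Proof.
move=> FF /cauchyP Fc.
have : cvg (fd_incl @ F).
  apply: cauchy_cvg; apply/cauchy_exP => e /Fc[z Fz].
  exists (fd_incl z); rewrite /fmap/=; apply: filterS Fz => w.
  by rewrite -!ball_normE.
move=> /cvg_ex[x Fx].
have Mx : x \in fd_pred.
  apply/asboolP; apply: (@closed_cvg _ _ F _ fd_incl (fd_set M)) Fx.
    by have [s ->] := fd_setP M; exact: span_closed.
  by apply: nearW => y; have /asboolP := valP y.
apply/cvg_ex; exists (exist _ x Mx : fd_carrier).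
apply/(@cvgrPdist_lt _ _ _ F _ id) => e e0.
exact: (@cvgrPdist_lt _ _ _ F _ fd_incl x).1.
Qed.

HB.instance Definition _ := Uniform_isComplete.Build fd_carrier fd_complete.

End fd_subspace.

Section tensor.
Context {K : fieldType} (X Y : lmodType K).

(* X (x) Y is realised inside the algebraic dual of the space of bilinear forms on
   X * Y, as the span of the evaluations A |-> A x y. As bilinear forms separate
   the points of an algebraic tensor product of vector spaces, two formal sums
   of pairs define the same element here iff they are equal in X (x) Y. *)
Definition bilin_form := {bilinear X -> Y -> K^o}.

Definition formal_sum (s : seq (X * Y)) : bilin_form -> K^o :=
  fun A => \sum_(z <- s) A z.1 z.2.

Definition tensor_pred : {pred bilin_form -> K^o} :=
  fun u => `[< exists s, u = formal_sum s >].

Lemma tensor_pred_closed : subsemimod_closed tensor_pred.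
Proof.
split; first split.
- by apply/asboolP; exists [::]; apply/funext => A; rewrite /formal_sum big_nil.
- move=> _ _ /asboolP[s ->] /asboolP[t ->]; apply/asboolP; exists (s ++ t).
  by apply/funext => A; rewrite /formal_sum big_cat.
- move=> a _ /asboolP[s ->]; apply/asboolP.
  exists [seq (a *: z.1, z.2) | z <- s]; apply/funext => A.
  rewrite scalrfctE /formal_sum big_map scaler_sumr.
  by apply: eq_bigr => z _; rewrite linearZl_LR.
Qed.

HB.instance Definition _ :=
  GRing.isSubmodClosed.Build K (bilin_form -> K^o) tensor_pred
    tensor_pred_closed.

Definition tensor := {u : bilin_form -> K^o | u \in tensor_pred}.

HB.instance Definition _ := [isSub of tensor for @sval _ _].
HB.instance Definition _ := [Choice of tensor by <:].
HB.instance Definition _ := [SubChoice_isSubLmodule of tensor by <:].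

Lemma elem_tensor_subproof (x : X) (y : Y) :
  (fun A : bilin_form => A x y) \in tensor_pred.
Proof.
apply/asboolP; exists [:: (x, y)]; apply/funext => A.
by rewrite /formal_sum big_seq1.
Qed.

Definition elem_tensor (x : X) (y : Y) : tensor :=
  exist (fun u => u \in tensor_pred) _ (elem_tensor_subproof x y).

Lemma sum_elem_tensorE (s : seq (X * Y)) :
  val (\sum_(z <- s) elem_tensor z.1 z.2) = formal_sum s.
Proof.
apply/funext => A; rewrite /formal_sum.
elim: s => [|z s IH]; first by rewrite !big_nil.
by rewrite !big_cons -IH.
Qed.

Lemma tensorP (u : tensor) : exists s, u = \sum_(z <- s) elem_tensor z.1 z.2.
Proof.
have /asboolP[s us] := valP u; exists s.
by apply: val_inj; rewrite sum_elem_tensorE.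
Qed.

End tensor.

Notation "x ⊗ y" := (elem_tensor x y) (at level 40, left associativity) : ring_scope.

Section tensor_map.
Context {K : fieldType} {X1 X2 Y1 Y2 : lmodType K}.
Variables (S1 : {linear X1 -> Y1}) (S2 : {linear X2 -> Y2}).

Section pullback.
Variable A : bilin_form Y1 Y2.

Definition pullback (x1 : X1) (x2 : X2) : K^o := A (S1 x1) (S2 x2).

Lemma pullback_bilinear : bilinear_for *:%R *:%R pullback.
Proof.
split=> [x2 a x y|x1 a x y]; rewrite /pullback linearP.
  by rewrite linearPl.
by rewrite linearPr.
Qed.

HB.instance Definition _ :=
  bilinear_isBilinear.Build K X1 X2 K^o *:%R *:%R pullback pullback_bilinear.

End pullback.

Lemma tensor_map_subproof (u : tensor X1 X2) :
  (fun A => val u (pullback A)) \in @tensor_pred K Y1 Y2.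
Proof.
have /asboolP[s us] := valP u; apply/asboolP.
exists [seq (S1 z.1, S2 z.2) | z <- s]; apply/funext => A.
by rewrite us /formal_sum big_map.
Qed.

Definition tensor_map (u : tensor X1 X2) : tensor Y1 Y2 :=
  exist (fun v => v \in @tensor_pred K Y1 Y2) _ (tensor_map_subproof u).

Lemma tensor_map_linear : linear tensor_map.
Proof. by move=> a u v; apply: val_inj. Qed.

HB.instance Definition _ := GRing.isLinear.Build
  K (tensor X1 X2) (tensor Y1 Y2) *:%R tensor_map tensor_map_linear.

Lemma tensor_map_elem x1 x2 : tensor_map (x1 ⊗ x2) = S1 x1 ⊗ S2 x2.
Proof. exact: val_inj. Qed.

End tensor_map.

Section form_product.
Context {K : fieldType} {X Y : lmodType K}.
Variables (f : {linear X -> K^o}) (g : {linear Y -> K^o}).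

Definition form_product (x : X) (y : Y) : K^o := f x * g y.

Lemma form_product_bilinear : bilinear_for *:%R *:%R form_product.
Proof.
split=> [y a x x'|x a y y']; rewrite /form_product linearP.
  by rewrite mulrDl; congr (_ + _); exact: (esym (mulrA a (f x) (g y))).
by rewrite mulrDr; congr (_ + _); exact: (mulrCA (f x) a (g y)).
Qed.

HB.instance Definition _ := bilinear_isBilinear.Build
  K X Y K^o *:%R *:%R form_product form_product_bilinear.

End form_product.

(* Norms on tensor products are valued in \bar R, finiteness being part of
   [is_norm]: the infima and suprema below then need no default value. *)
Definition is_norm (R : realType) (k : scalar_kind) (V : lmodType (scalar_field R k))
    (N : V -> \bar R) : Prop :=
  [/\ forall u, (0 <= N u < +oo)%E,
      forall u, N u = 0%E -> u = 0,
      forall (a : scalar_field R k) u,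
        N (a *: u) = ((nrm (a : (scalar_field R k)^o))%:E * N u)%E &
      forall u v : V, (N (u + v)%R <= N u + N v)%E].

Definition opnorm (R : realType) (V W : Type) (NV : V -> \bar R)
    (NW : W -> \bar R) (T : V -> W) : \bar R :=
  ereal_sup [set NW (T v) | v in [set v | (NV v <= 1)%E]].

Definition enrm (R : realType) (k : scalar_kind)
    (V : normedModType (scalar_field R k)) (x : V) : \bar R := (nrm x)%:E.

Section tensor_norms.
Context {R : realType} {k : scalar_kind}.
Local Notation K := (scalar_field R k).
Local Notation banach := (completeNormedModType K).

(* [val u (form_product f g)] is (f (x) g)(u), i.e. \sum_j f x_j * g y_j for any
   representation u = \sum_j x_j (x) y_j. *)
Definition injective_norm (X Y : banach) (u : tensor X Y) : \bar R :=
  ereal_sup [set r | exists (f : dual X) (g : dual Y),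
    [/\ nrm f <= 1, nrm g <= 1 & r = enrm (val u (form_product f g))]].

Definition projective_norm (X Y : banach) (u : tensor X Y) : \bar R :=
  ereal_inf [set (\sum_(z <- s) nrm z.1 * nrm z.2)%:E | s in
    [set s : seq (X * Y) | u = \sum_(z <- s) z.1 ⊗ z.2]].

Definition reasonable_crossnorm (X Y : banach) (alpha : tensor X Y -> \bar R) :=
  is_norm alpha /\
  forall u, (injective_norm u <= alpha u <= projective_norm u)%E.

Definition tensor_norm
    (alpha : forall X Y : banach, tensor X Y -> \bar R) : Prop :=
  (forall X Y : banach, reasonable_crossnorm (@alpha X Y)) /\
  (forall (X1 X2 Y1 Y2 : banach)
      (S1 : {linear X1 -> Y1}) (S2 : {linear X2 -> Y2}),
    continuous S1 -> continuous S2 ->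
    (opnorm (@alpha X1 X2) (@alpha Y1 Y2) (tensor_map S1 S2)
      <= opnorm (@enrm R k X1) (@enrm R k Y1) S1 *
         opnorm (@enrm R k X2) (@enrm R k Y2) S2)%E).

Definition finitely_generated
    (alpha : forall X Y : banach, tensor X Y -> \bar R) : Prop :=
  forall (X Y : banach) (u : tensor X Y),
    alpha X Y u = ereal_inf [set r |
      exists (M : fd_subspace X) (N : fd_subspace Y)
             (v : tensor (fd_carrier M) (fd_carrier N)),
        tensor_map (@fd_incl _ _ X M) (@fd_incl _ _ Y N) v = u /\
        r = alpha (fd_carrier M) (fd_carrier N) v].

End tensor_norms.

Section gamma.
Context {R : realType} {k : scalar_kind}.
Local Notation K := (scalar_field R k).

(* In [strong_norm] and [mid_norm] an infinite exponent means the sup norm; -oo is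
   never used. *)
Definition strong_norm (q : \bar R) (Z : normedModType K) (z : nat -> Z) :
    \bar R :=
  match q with
  | q%:E => ((\sum_(0 <= j <oo) (nrm (z j) `^ q)%:E) `^ q^-1)%E
  | _ => ereal_sup (range (fun j => enrm (z j)))
  end.

Definition weak_norm (q : R) (Z : normedModType K) (z : nat -> Z) : \bar R :=
  ereal_sup [set ((\sum_(0 <= j <oo) (nrm (f (z j)) `^ q)%:E) `^ q^-1)%E |
    f in [set f : dual Z | nrm f <= 1]].

Definition mid_norm (q : \bar R) (Z : normedModType K) (z : nat -> Z) :
    \bar R :=
  match q with
  | q%:E =>
    ereal_sup [set ((\sum_(0 <= n <oo) \sum_(0 <= j <oo)
                       (nrm (f n (z j)) `^ q)%:E) `^ q^-1)%E |
      f in [set f : nat -> dual Z | (weak_norm q f <= 1)%E]]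
  | _ => strong_norm q z
  end.

Definition zero_extend (Z : normedModType K) (s : seq Z) : nat -> Z :=
  fun j => s`_j.

Definition gamma (p : \bar R) (X Y : completeNormedModType K)
    (u : tensor X Y) : \bar R :=
  ereal_inf [set (mid_norm (hoelder_conjugate p) (zero_extend (unzip1 s)) *
                  strong_norm p (zero_extend (unzip2 s)))%E |
    s in [set s : seq (X * Y) | u = \sum_(z <- s) z.1 ⊗ z.2]].

End gamma.

(* Main.v *)
Require Import Defs.
From HB Require Import structures.
From mathcomp Require Import all_boot all_order all_algebra.
From mathcomp Require Import all_classical all_reals ereal topology.
From mathcomp Require Import normedtype sequences exp hoelder.
From mathcomp Require Import sesquilinear ring lra.
From mathcomp.real_closed Require Import complex.
(* [vector] exports another [span]. *)
Import Defs.
Set Implicit Arguments.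
Unset Strict Implicit.
Unset Printing Implicit Defensive.
Import Order.TTheory GRing.Theory Num.Theory.
Import numFieldNormedType.Exports.
Local Open Scope classical_set_scope.
Local Open Scope ring_scope.

(* By duality of finite l_q spaces, a finite family (f_i) of functionals on Z has
   weak l_q-norm at most 1 iff \sum_i |f_i(x)|^q <= ||x||^q for all x in Z, so that
   only finite families and points of Z enter the mid norm. Representations whose
   mid and strong norms are balanced as A^(1/q) and A^(1/p), with q the conjugate
   exponent, concatenate, whence the triangle inequality; Young's inequality gives
   the lower bound by the injective norm, and the Hahn-Banach theorem the
   definiteness.

   As the strong norm only sees the vectors themselves, finite generation amounts
   to ||(x_j)||^mid in X being the infimum of the mid norms in the
   finite-dimensional subspaces M containing the x_j. Given almost extremal weakly
   bounded families on the M's, merge the functionals having nearly proportional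
   values on (x_j): by convexity this does not increase the weak norm and
   hardly decreases the sum, and it leaves a number of functionals independent of M,
   so that an ultrafilter limit along M yields a competitor on X. *)

(** * Powers of real numbers *)

Section real_powers.
Context {R : realType}.
Implicit Types (q t s b c : R).

(** Young's inequality for [t ^ (q - 1)] and [b], written without the conjugate exponent
    [q / (q - 1)] so as to cover [q = 1] as well. *)
Lemma young_powR q t b : 1 <= q -> 0 <= t -> 0 <= b ->
  t `^ (q - 1) * b <= (1 - q^-1) * t `^ q + b `^ q / q.
Proof.
rewrite le_eqVlt => /predU1P[<- t0 b0|q1 t0 b0].
  by rewrite subrr powRr0 invr1 subrr mul0r add0r mul1r powRr1// mulr1.
have q0 : 0 < q by lra.
have q10 : q - 1 != 0 by lra.
have qq : (q / (q - 1))^-1 = 1 - q^-1.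
  by rewrite invf_div mulrBl divff ?gt_eqF// mul1r.
have -> : t `^ q = (t `^ (q - 1)) `^ (q / (q - 1)).
  by rewrite -powRrM mulrCA divff// mulr1.
rewrite -qq [X in _ <= X + _]mulrC.
apply: conjugate_powR => //; [exact: powR_ge0|by rewrite divr_gt0//; lra|].
by rewrite qq subrK.
Qed.

(** Jensen's inequality for the [q]-th power. With [s] the weighted mean, [s ^ q] is the mean of the
    [s ^ (q - 1) * f i]; Young's inequality bounds each of these, and the part [(1 - 1 / q) * s ^ q]
    is absorbed on the left. *)
Lemma powR_sum_le (I : Type) (r : seq I) (P : pred I) (w f : I -> R) q :
  1 <= q -> (forall i, 0 <= w i) -> (forall i, 0 <= f i) ->
  \sum_(i <- r | P i) w i = 1 ->
  (\sum_(i <- r | P i) w i * f i) `^ q <= \sum_(i <- r | P i) w i * f i `^ q.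
Proof.
move=> q1 w0 f0 w1; have q0 : 0 < q by lra.
set s := \sum_(i <- r | P i) _.
have s0 : 0 <= s by apply: sumr_ge0 => i _; rewrite mulr_ge0.
have : s `^ q <= (1 - q^-1) * s `^ q + (\sum_(i <- r | P i) w i * f i `^ q) / q.
  have sE : s `^ q = \sum_(i <- r | P i) w i * (s `^ (q - 1) * f i).
    rewrite -(@mulr_powRB1 _ s)// mulrC {2}/s mulr_sumr.
    by apply: eq_bigr => i _; rewrite mulrCA.
  suff : \sum_(i <- r | P i) w i * (s `^ (q - 1) * f i) <=
      (\sum_(i <- r | P i) w i) * ((1 - q^-1) * s `^ q) +
      (\sum_(i <- r | P i) w i * f i `^ q) / q.
    by rewrite w1 mul1r -sE.
  rewrite !mulr_suml -big_split/=.
  apply: ler_sum => i _; rewrite -mulrA -mulrDr ler_wpM2l//.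
  exact: young_powR.
rewrite mulrBl mul1r -addrA lerDl addrC [_^-1 * _]mulrC -mulrBl pmulr_lge0 ?invr_gt0//.
by rewrite subr_ge0.
Qed.

Lemma ler_powR_nneg q s t : 0 <= q -> 0 <= s -> s <= t -> s `^ q <= t `^ q.
Proof.
move=> q0 s0 st; apply: ge0_ler_powR => //; rewrite nnegrE//; exact: le_trans st.
Qed.

Lemma powR_le_nneg q s t : 0 < q -> 0 <= s -> 0 <= t -> s `^ q <= t `^ q -> s <= t.
Proof.
move=> q0 s0 t0; apply: contraTT; rewrite -!ltNge => ts.
by rewrite gt0_ltr_powR// nnegrE.
Qed.

Lemma powRVK q t : q != 0 -> 0 <= t -> (t `^ q^-1) `^ q = t.
Proof. by move=> q0 t0; rewrite -powRrM mulVf// powRr1. Qed.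

Lemma powRKV q t : q != 0 -> 0 <= t -> (t `^ q) `^ q^-1 = t.
Proof. by move=> q0 t0; rewrite -powRrM mulfV// powRr1. Qed.

(* Bernoulli's inequality for the ratio [s / t]. *)
Lemma powR_lipschitz q : 1 <= q -> exists2 L : R, 0 < L &
  forall s t, 0 <= s -> 0 <= t -> t <= 1 -> t `^ q - s `^ q <= L * `|t - s|.
Proof.
move=> q1; have q0 : 0 <= q by lra.
(* Raising the exponent to an integer lowers the powers of [s / t <= 1], so Bernoulli's inequality
   is needed for integer exponents only. *)
pose N := (Num.truncn q).+1; have qN : q <= N%:R by exact/ltW/truncnS_gt.
exists N%:R => // s t s0 t0 t1.
have [ts|st] := leP t s.
  rewrite (@le_trans _ _ 0)// ?mulr_ge0// subr_le0; exact: ler_powR_nneg.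
have t0' : 0 < t by exact: le_lt_trans st.
have bern (n : nat) (x : R) : 0 <= x <= 1 -> 1 - n%:R * (1 - x) <= x ^+ n.
  move=> /andP[x0 x1]; elim: n => [|n IH]; first by rewrite mul0r subr0 expr0.
  rewrite exprS; apply: le_trans (ler_wpM2l x0 IH); rewrite -natr1.
  have : 0 <= n%:R * (1 - x) ^+ 2 :> R by rewrite mulr_ge0// sqr_ge0.
  by lra.
have [->|s0'] := eqVneq s 0.
  rewrite powR0 ?gt_eqF//; last lra.
  rewrite !subr0 gtr0_norm// (@le_trans _ _ t)//; last by rewrite ler_peMl// ler1n.
  by apply: ge1r_powR => //; rewrite t0'.
have {}s0' : 0 < s by rewrite lt_neqAle eq_sym s0' s0.
have x01 : 0 < s / t <= 1 by rewrite divr_gt0//= ler_pdivrMr// mul1r ltW.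
have -> : s `^ q = t `^ q * (s / t) `^ q.
  by rewrite -powRM ?divr_ge0// mulrCA divff ?mulr1// gt_eqF.
rewrite -[X in X - _]mulr1 -mulrBr gtr0_norm ?subr_gt0//.
have h1 : 1 - (s / t) `^ q <= N%:R * (1 - s / t).
  rewrite lerBlDr -lerBlDl (le_trans (bern N (s / t) _))//.
    by case/andP: x01 => /ltW -> ->.
  by rewrite -powR_mulrn ?divr_ge0// ger_powR.
have h2 : t `^ q <= t by apply: ge1r_powR => //; rewrite t0'.
have h3 : N%:R * (t - s) = t * (N%:R * (1 - s / t)).
  by field; rewrite gt_eqF.
rewrite h3 (le_trans (ler_wpM2l (powR_ge0 _ _) h1))// ler_wpM2r// mulr_ge0//.
by case/andP: x01 => _; rewrite subr_ge0.
Qed.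

End real_powers.

(** * Functionals *)

Section scalars.
Context {R : realType} {k : scalar_kind}.
Local Notation K := (scalar_field R k).

Lemma nrmN (V : normedModType K) (x : V) : nrm (- x) = nrm x.
Proof. by rewrite /nrm normrN. Qed.

Lemma nrmB (V : normedModType K) (x y : V) : nrm (x - y) = nrm (y - x).
Proof. by rewrite -nrmN opprB. Qed.

Lemma nrm_sum (V : normedModType K) (I : Type) (r : seq I) (P : pred I)
    (F : I -> V) :
  nrm (\sum_(i <- r | P i) F i) <= \sum_(i <- r | P i) nrm (F i).
Proof.
elim/big_ind2 : _ => //; first by rewrite nrm0.
by move=> x a y b xa yb; apply: le_trans (nrmD _ _) _; exact: lerD.
Qed.

Lemma nrmM (a b : K) : nrm (a * b : K^o) = nrm (a : K^o) * nrm (b : K^o).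
Proof. exact: (@nrmZ _ _ K^o a b). Qed.

Lemma nrmV (a : K) : nrm (a^-1 : K^o) = (nrm (a : K^o))^-1.
Proof.
have [->|a0] := eqVneq a 0; first by rewrite invr0 !nrm0 invr0.
have na0 : nrm (a : K^o) != 0 by apply: contra_neq a0; exact: nrm0_eq0.
by apply: (mulfI na0); rewrite -nrmM !divff// nrm1.
Qed.

Lemma nrm_scal_real (c : R) : 0 <= c -> nrm (scal_real k c : K^o) = c.
Proof.
move=> c0; apply: (@scal_real_inj R k); rewrite nrmE ger0_norm//.
by rewrite -(@scal_real0 R k) le_scal_real.
Qed.

Lemma powR_nrm0 (V : normedModType K) (q : R) : q != 0 -> nrm (0 : V) `^ q = 0.
Proof. by move=> q0; rewrite nrm0 powR0. Qed.

Lemma scal_real_sum (I : Type) (r : seq I) (P : pred I) (F : I -> R) :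
  scal_real k (\sum_(i <- r | P i) F i) = \sum_(i <- r | P i) scal_real k (F i).
Proof.
by elim/big_rec2 : _ => [|i a b _ <-]; rewrite ?scal_real0 ?scal_realD.
Qed.

End scalars.

Section duals.
Context {R : realType} {k : scalar_kind}.
Local Notation K := (scalar_field R k).
Variable V : normedModType K.

Lemma bounded_linear_continuous (W : normedModType K) (h : {linear V -> W})
    (B : R) : (forall x, nrm (h x) <= B * nrm x) -> continuous h.
Proof.
move=> hB; apply/linear_bounded_continuous/linear_boundedP.
have B0 : (0 <= Num.max B 0) by rewrite le_max lexx orbT.
near=> r => x; rewrite -!nrmE.
have rB : scal_real k (Num.max B 0) <= r by near: r; apply: nbhs_pinfty_ge;
    rewrite ger0_real// -(@scal_real0 R k) le_scal_real.
apply: (@le_trans _ _ (scal_real k (Num.max B 0) * scal_real k (nrm x))).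
  rewrite -scal_realM le_scal_real (le_trans (hB x))//.
  by rewrite ler_wpM2r ?nrm_ge0// le_max lexx.
by rewrite ler_wpM2r// -(@scal_real0 R k) le_scal_real nrm_ge0.
Unshelve. all: end_near. Qed.

Lemma dual_of_bounded (h : V -> K^o) (B : R) : linear h ->
  (forall x, nrm (h x) <= B * nrm x) -> exists f : dual V, forall x, f x = h x.
Proof.
move=> lh hB.
pose H : {linear V -> K^o} :=
  HB.pack h (GRing.isLinear.Build K V K^o *:%R h lh).
have hc : continuous h by exact: (@bounded_linear_continuous _ H B).
have hd : h \in @dual_pred R k V by apply/asboolP.
by exists (exist _ h hd).
Qed.

Lemma nrm_dual_apply (f : dual V) x : nrm (f x) <= nrm f * nrm x.
Proof.
have [->|x0] := eqVneq x 0; first by rewrite linear0 !nrm0 mulr0.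
have nx0 : nrm x != 0 by apply: contra_neq x0; exact: nrm0_eq0.
have nx : 0 < nrm x by rewrite lt_neqAle eq_sym nx0 nrm_ge0.
have := @dual_norm_ge _ _ _ f (scal_real k (nrm x)^-1 *: x).
rewrite linearZ_LR !nrmZ nrm_scal_real ?invr_ge0 ?nrm_ge0// mulVf// nrm_dual.
by move=> /(_ (lexx _)); rewrite ler_pdivrMl// mulrC.
Qed.

Lemma nrm_dual_le (f : dual V) (B : R) :
  (forall x, nrm (f x) <= B * nrm x) -> 0 <= B -> nrm f <= B.
Proof.
move=> fB B0; rewrite nrm_dual; apply: dual_norm_le => x x1.
by rewrite (le_trans (fB x))// ler_piMr.
Qed.

End duals.

Section bidual.
Context {R : realType} {k : scalar_kind}.
Local Notation K := (scalar_field R k).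
Variable V : normedModType K.

Lemma dual_eval (x : V) : exists2 e : dual (dual V),
  forall f : dual V, e f = f x & nrm e <= nrm x.
Proof.
have eB (f : dual V) : nrm (f x) <= nrm x * nrm f.
  by rewrite mulrC nrm_dual_apply.
have [//|e eE] := @dual_of_bounded _ _ (dual V) (fun f : dual V => f x) (nrm x) _ eB.
exists e => //; apply: nrm_dual_le; last exact: nrm_ge0.
by move=> f; rewrite eE.
Qed.

Lemma dual_sumE (I : Type) (r : seq I) (P : pred I) (F : I -> dual V) (x : V) :
  (\sum_(i <- r | P i) F i : dual V) x = \sum_(i <- r | P i) F i x :> K.
Proof. by elim/big_rec2 : _ => // i a b _ <-. Qed.

Lemma dual_comp (W : normedModType K) (S : {linear W -> V}) (B : R)
    (f : dual V) : (forall x, nrm (S x) <= B * nrm x) ->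
  exists g : dual W, forall x, g x = f (S x).
Proof.
move=> SB; apply: (@dual_of_bounded _ _ _ _ (nrm f * B)) => [a x y|x].
  by rewrite !linearP.
by rewrite (le_trans (nrm_dual_apply f _))// -mulrA ler_wpM2l// nrm_ge0.
Qed.

End bidual.

(** * Weak, mid and strong norms of finite families *)

(** Removes the outer root from the extended-real norms, turning bounds on them into bounds on sums
    of [q]-th powers. *)
Lemma poweRV_le (R : realType) (q c : R) (x : \bar R) : 0 < q -> 0 <= c ->
  (0 <= x)%E -> ((x `^ q^-1)%E <= c%:E)%E = (x <= (c `^ q)%:E)%E.
Proof.
move=> q0 c0; have q0' : q != 0 by rewrite gt_eqF.
case: x => [x x0||]//.
  rewrite poweR_EFin !lee_fin; rewrite lee_fin in x0.
  apply/idP/idP => xc.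
    rewrite -[x](powRVK q0')//; apply: ler_powR_nneg => //; first exact: ltW.
    exact: powR_ge0.
  rewrite -[c](powRKV q0')//; apply: ler_powR_nneg => //.
  by rewrite invr_ge0 ltW.
by rewrite poweRyr ?invr_eq0// => _; apply/idP/idP; rewrite leye_eq.
Qed.

Section sequence_norms.
Context {R : realType} {k : scalar_kind}.
Local Notation K := (scalar_field R k).
Implicit Type (V : normedModType K).

Lemma nneseries_zero_extend V (F : V -> \bar R) (s : seq V) :
  (forall x, 0 <= F x)%E -> F 0 = 0%E ->
  (\sum_(0 <= j <oo) F (zero_extend s j) = \sum_(x <- s) F x)%E.
Proof.
move=> F0 Fz; rewrite (@nneseries_split _ _ _ (size s))//.
rewrite [X in (_ + X)%E]eseries0 ?adde0 => [|j js _].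
  by rewrite add0n [RHS](big_nth 0).
by rewrite /zero_extend nth_default// -[size s]add0n.
Qed.

(* [weak_le1 q l]: the finite family [l] has weak [l_q]-norm at most 1, tested on
   the points of V only instead of the whole bidual. *)
Definition weak_le1 V (q : R) (l : seq (dual V)) : Prop :=
  forall x : V, \sum_(f <- l) nrm (f x) `^ q <= nrm x `^ q.

(** Root-free form of a bound on the mid norm, tested on finite families of functionals only;
    [mid_normP] shows the equivalence. *)
Definition mid_le V (q : \bar R) (s : seq V) (c : R) : Prop :=
  match q with
  | q%:E => forall l : seq (dual V), weak_le1 q l ->
      \sum_(f <- l) \sum_(x <- s) nrm (f x) `^ q <= c `^ q
  | _ => {in s, forall x, nrm x <= c}
  end.

Definition strong_le V (q : \bar R) (s : seq V) (c : R) : Prop :=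
  match q with
  | q%:E => \sum_(x <- s) nrm x `^ q <= c `^ q
  | _ => {in s, forall x, nrm x <= c}
  end.

(* Evaluating [phi] at [\sum_(f <- l) conj(sgn(phi f)) |phi f|^(q-1) f] reduces the
   bidual to the points of [V]. *)
Lemma weak_le1_norm V (q : R) (l : seq (dual V)) : 1 <= q ->
  weak_le1 q l -> (weak_norm q (zero_extend l) <= 1)%E.
Proof.
move=> q1 lq; have q0 : 0 < q by lra.
apply: ge_ereal_sup => _ [phi /= phi1 <-].
rewrite poweRV_le// ?nneseries_ge0//; last by move=> *; rewrite lee_fin powR_ge0.
rewrite powR1 (@nneseries_zero_extend _ (fun f => (nrm (phi f) `^ q)%:E)); first last.
- by rewrite linear0 powR_nrm0// gt_eqF.
- by move=> f; rewrite lee_fin powR_ge0.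
rewrite sumEFin lee_fin.
set S := \sum_(f <- l) _.
(* The last factor is the conjugate sign of [phi f]; it is 0 when [phi f = 0], since 0 has inverse
   0. *)
pose lam (f : dual V) : K := scal_real k (nrm (phi f) `^ (q - 1)) *
  (scal_real k (nrm (phi f)) / phi f).
have lamE f : lam f * phi f = scal_real k (nrm (phi f) `^ q).
  have [e|e] := eqVneq (phi f : K) 0.
    by rewrite e mulr0 powR_nrm0 ?gt_eqF// scal_real0.
  rewrite /lam -mulrA divfK// -scal_realM mulrC mulrC [_ * nrm _]mulrC.
  by rewrite mulr_powRB1// nrm_ge0.
have lam_nrm f : nrm (lam f : K^o) <= nrm (phi f) `^ (q - 1).
  rewrite /lam !nrmM nrmV !nrm_scal_real ?nrm_ge0 ?powR_ge0//.
  rewrite ler_piMr ?powR_ge0//.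
  have [->|n0] := eqVneq (nrm (phi f)) 0; first by rewrite mul0r.
  by rewrite divff.
pose g : dual V := \sum_(f <- l) lam f *: f.
have gE : phi g = scal_real k S :> K.
  rewrite /g linear_sum /S.
  rewrite scal_real_sum.
  by apply: eq_bigr => f _; rewrite linearZ_LR -lamE.
have S0 : 0 <= S by apply: sumr_ge0 => f _; exact: powR_ge0.
have Sg : S <= nrm g.
  rewrite -(nrm_scal_real (k := k) S0) -gE (le_trans (nrm_dual_apply phi g))//.
  by rewrite ler_piMl// nrm_ge0.
(* Young's inequality inside the dual norm of [g] bounds it by the right-hand side, and the
   resulting inequality forces [S <= 1]. *)
have : S <= (1 - q^-1) * S + q^-1.
  apply: (le_trans Sg); rewrite nrm_dual; apply: dual_norm_le => x x1.
  rewrite dual_sumE; apply: (le_trans (nrm_sum _ _ _)).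
  apply: (@le_trans _ _ (\sum_(f <- l) ((1 - q^-1) * nrm (phi f) `^ q +
      nrm (f x) `^ q / q))).
    apply: ler_sum => f _.
    rewrite (le_trans _ (young_powR q1 (nrm_ge0 (phi f)) (nrm_ge0 (f x))))//.
    rewrite [X in nrm X](_ : _ = lam f *: f x)//.
    by rewrite nrmZ ler_wpM2r ?nrm_ge0.
  rewrite big_split/= -mulr_sumr -mulr_suml lerD2l -[leRHS]mul1r ler_wpM2r//.
    by rewrite invr_ge0 ltW.
  have e1 : 1 `^ q = 1 :> R by rewrite powR1.
  rewrite (le_trans (lq x))// -[leRHS]e1; apply: ler_powR_nneg => //.
    exact: ltW.
  exact: nrm_ge0.
rewrite mulrBl mul1r -addrA lerDl addrC -[X in X - _]mulr1 -mulrBr.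
by rewrite pmulr_rge0 ?invr_gt0// subr_ge0.
Qed.

(** Evaluation at [x / |x|] lies in the unit ball of the bidual, so the weak norm controls the
    partial sums there; homogeneity brings back [x]. *)
Lemma weak_norm_le1 V (q : R) (f : nat -> dual V) (n : nat) : 1 <= q ->
  (weak_norm q f <= 1)%E -> weak_le1 q (mkseq f n).
Proof.
move=> q1 fq x; have q0 : 0 < q by lra.
have [->|x0] := eqVneq x 0.
  rewrite big1 ?powR_ge0// => g _; by rewrite linear0 powR_nrm0// gt_eqF.
have nx0 : nrm x != 0 by apply: contra_neq x0; exact: nrm0_eq0.
have [e eE e1] := dual_eval (scal_real k (nrm x)^-1 *: x).
have {}e1 : nrm e <= 1.
  by rewrite (le_trans e1)// nrmZ nrm_scal_real ?invr_ge0 ?nrm_ge0// mulVf.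
have : ((\sum_(0 <= j <oo) (nrm (e (f j)) `^ q)%:E) `^ q^-1 <= 1)%E.
  by apply: le_trans fq; apply: ereal_sup_ubound; exists e.
rewrite poweRV_le// ?nneseries_ge0//; last by move=> *; rewrite lee_fin powR_ge0.
rewrite powR1; move=> /(le_trans (@nneseries_lim_ge _ _ xpredT 0 n _)).
move=> /(_ (fun j _ _ => powR_ge0 _ _)); rewrite sumEFin lee_fin => ef.
rewrite /index_iota subn0 in ef; rewrite /mkseq big_map.
rewrite -[leRHS]mulr1; apply: le_trans (ler_wpM2l (powR_ge0 _ _) ef).
rewrite mulr_sumr; apply: ler_sum => j _.
rewrite eE linearZ_LR nrmZ nrm_scal_real ?invr_ge0 ?nrm_ge0//.
by rewrite -powRM ?mulr_ge0 ?invr_ge0 ?nrm_ge0// mulrA divff// mul1r.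
Qed.

Lemma sup_normP V (s : seq V) (c : R) : 0 <= c ->
  (ereal_sup (range (fun j => enrm (zero_extend s j))) <= c%:E)%E <->
  {in s, forall x, nrm x <= c}.
Proof.
move=> c0; split=> [sc x xs|sc].
  rewrite -lee_fin; apply: le_trans sc; apply: ereal_sup_ubound.
  by exists (index x s) => //; rewrite /zero_extend nth_index.
apply: ge_ereal_sup => _ [j _ <-]; rewrite lee_fin /zero_extend.
have [js|sj] := ltnP j (size s); first exact/sc/mem_nth.
by rewrite nth_default// nrm0.
Qed.

Lemma strong_normP V (q : \bar R) (s : seq V) (c : R) : (1 <= q)%E -> 0 <= c ->
  (strong_norm q (zero_extend s) <= c%:E)%E <-> strong_le q s c.
Proof.
case: q => [q||]//; last by move=> _; exact: sup_normP.
rewrite lee_fin /= => q1 c0; have q0 : 0 < q by lra.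
rewrite poweRV_le// ?nneseries_ge0//; last by move=> *; rewrite lee_fin powR_ge0.
rewrite (@nneseries_zero_extend _ (fun x => (nrm x `^ q)%:E)); first last.
- by rewrite powR_nrm0// gt_eqF.
- by move=> x; rewrite lee_fin powR_ge0.
by rewrite sumEFin lee_fin.
Qed.

Lemma mid_normP V (q : \bar R) (s : seq V) (c : R) : (1 <= q)%E -> 0 <= c ->
  (mid_norm q (zero_extend s) <= c%:E)%E <-> mid_le q s c.
Proof.
case: q => [q||]//; last by move=> _; exact: sup_normP.
rewrite lee_fin /= => q1 c0; have q0 : 0 < q by lra.
have qN0 : q != 0 by rewrite gt_eqF.
have inner (g : dual V) : (\sum_(0 <= j <oo) (nrm (g (zero_extend s j)) `^ q)%:E =
    (\sum_(x <- s) nrm (g x) `^ q)%:E)%E.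
  rewrite (@nneseries_zero_extend _ (fun x => (nrm (g x) `^ q)%:E)) ?sumEFin//.
    by move=> x; rewrite lee_fin powR_ge0.
  by rewrite linear0 powR_nrm0.
have inner0 (g : dual V) : (0 <= (\sum_(x <- s) nrm (g x) `^ q)%:E)%E.
  by rewrite lee_fin sumr_ge0// => x _; exact: powR_ge0.
split=> [sc l lq|sc].
  have : ((\sum_(0 <= n <oo) \sum_(0 <= j <oo)
      (nrm ((zero_extend l n : dual V) (zero_extend s j)) `^ q)%:E) `^ q^-1 <= c%:E)%E.
    apply: le_trans sc; apply: ereal_sup_ubound; exists (zero_extend l) => //.
    exact: weak_le1_norm.
  rewrite poweRV_le//; last first.
    by apply: nneseries_ge0 => n _ _; rewrite inner.
  under eq_eseriesr do rewrite inner.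
  rewrite (@nneseries_zero_extend (dual V) (fun g : dual V => (\sum_(x <- s) nrm (g x) `^ q)%:E))//.
    by rewrite sumEFin lee_fin.
  by rewrite big1// => x _; rewrite [X in nrm X](_ : _ = 0 :> K^o)// powR_nrm0.
apply: ge_ereal_sup => _ [f /= f1 <-].
rewrite poweRV_le//; last by apply: nneseries_ge0 => n _ _; rewrite inner.
under eq_eseriesr do rewrite inner.
(* Each partial sum over the functionals involves a finite family, to which the hypothesis
   applies. *)
apply: lime_le; first by apply: is_cvg_nneseries => n _ _.
apply: nearW => n; rewrite sumEFin lee_fin.
have := sc _ (weak_norm_le1 n q1 f1).
by rewrite /mkseq big_map /index_iota subn0.
Qed.

End sequence_norms.

(** * Conjugate exponents *)

Section hoelder_conjugate.
Context {R : realType}.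
Implicit Type p : \bar R.

Variant hoelder_conjugate_spec : \bar R -> \bar R -> Prop :=
| HoelderConjugate1 : hoelder_conjugate_spec 1%:E +oo
| HoelderConjugatey : hoelder_conjugate_spec +oo 1%:E
| HoelderConjugateFin (r s : R) : 1 < r -> 1 < s -> r^-1 + s^-1 = 1 ->
    hoelder_conjugate_spec r%:E s%:E.

Lemma hoelder_conjugate_ge1P p : (1 <= p)%E ->
  hoelder_conjugate_spec p (hoelder_conjugate p).
Proof.
case: p => [r||]//; last by rewrite hoelder_conjugatey; constructor.
rewrite lee_fin le_eqVlt => /predU1P[<-|r1].
  by rewrite hoelder_conjugate1; constructor.
have r10 : r - 1 != 0 by lra.
have r0 : r != 0 by lra.
have -> : hoelder_conjugate r%:E = (r / (r - 1))%:E.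
  by rewrite /hoelder_conjugate/= eqe (negbTE r0) -EFinB inver (negbTE r10) -EFinM.
constructor => //; first by rewrite ltr_pdivlMr; lra.
by rewrite invf_div; field; rewrite r0.
Qed.

Lemma hoelder_conjugate_ge1 p : (1 <= p)%E -> (1 <= hoelder_conjugate p)%E.
Proof.
by move=> /hoelder_conjugate_ge1P[||r s r1 s1 _]; rewrite ?leey// lee_fin ltW.
Qed.

(** [A ^ (1 / p)], with [1 / p] read as 0 for an infinite exponent: the roots for two conjugate
    exponents then multiply to [A]. *)
Definition eroot p (A : R) : R := if p is r%:E then A `^ r^-1 else 1.

Lemma eroot_ge0 p A : 0 <= eroot p A.
Proof. by case: p => [r||]//=; exact: powR_ge0. Qed.

Lemma eroot_conjugate p A : (1 <= p)%E -> 0 <= A ->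
  eroot (hoelder_conjugate p) A * eroot p A = A.
Proof.
move=> /hoelder_conjugate_ge1P[||r s r1 s1 rs] A0 /=.
- by rewrite invr1 powRr1// mul1r.
- by rewrite invr1 powRr1// mulr1.
- by rewrite -powRD addrC rs ?powRr1// oner_eq0.
Qed.

Lemma eroot_gt0 p A : 0 < A -> 0 < eroot p A.
Proof. by move=> A0; case: p => [r||]//=; exact: powR_gt0. Qed.

End hoelder_conjugate.

(** * Images and concatenations of finite families *)

Section finite_families.
Context {R : realType} {k : scalar_kind}.
Local Notation K := (scalar_field R k).
Implicit Types (V W : normedModType K) (q : \bar R).

Lemma mid_leW V q (s : seq V) (c d : R) : (1 <= q)%E -> 0 <= c -> c <= d ->
  mid_le q s c -> mid_le q s d.
Proof.
case: q => [q||]//=; last by move=> _ c0 cd sc x /sc/le_trans; exact.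
rewrite lee_fin => q1 c0 cd sc l /sc/le_trans; apply; apply: ler_powR_nneg => //.
lra.
Qed.

Lemma strong_leW V q (s : seq V) (c d : R) : (1 <= q)%E -> 0 <= c -> c <= d ->
  strong_le q s c -> strong_le q s d.
Proof.
case: q => [q||]//=; last by move=> _ c0 cd sc x /sc/le_trans; exact.
rewrite lee_fin => q1 c0 cd sc; apply: (le_trans sc); apply: ler_powR_nneg => //.
lra.
Qed.

(** As [S / a] is a contraction, composing with it pulls weakly bounded families on [W] back to
    weakly bounded families on [V]. *)
Lemma mid_le_map V W (S : {linear V -> W}) (a : R) q (s : seq V) (c : R) :
  (1 <= q)%E -> 0 <= a -> 0 <= c -> (forall x, nrm (S x) <= a * nrm x) ->
  mid_le q s c -> mid_le q (map S s) (a * c).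
Proof.
case: q => [q||]//=; last first.
  move=> _ a0 c0 Sa sc _ /mapP[x xs ->].
  by rewrite (le_trans (Sa x))// ler_wpM2l// sc.
rewrite lee_fin => q1 a0 c0 Sa sc l lq; have q0 : 0 < q by lra.
(* For [a = 0] there is no dividing by [a], but [S] vanishes. *)
move: a0; rewrite le_eqVlt => /predU1P[a0|a0].
  have S0 x : S x = 0.
    by apply: nrm0_eq0; apply/eqP; rewrite eq_le nrm_ge0 (le_trans (Sa x))// -a0 mul0r.
  rewrite big1 ?powR_ge0// => f _; rewrite big_map big1// => x _.
  by rewrite S0 linear0 powR_nrm0// gt_eqF.
pose comp (f : dual W) := projT1 (cid (dual_comp f Sa)).
have compE f x : comp f x = f (S x) by exact: (projT2 (cid (dual_comp f Sa)) x).
have pE f x : nrm ((scal_real k a^-1 *: comp f : dual V) x) `^ q =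
    a^-1 `^ q * nrm (f (S x)) `^ q.
  rewrite [X in nrm X](_ : _ = scal_real k a^-1 *: comp f x)// compE nrmZ.
  by rewrite nrm_scal_real ?invr_ge0 ?ltW// powRM ?invr_ge0 ?nrm_ge0 ?ltW.
pose l' : seq (dual V) := [seq scal_real k a^-1 *: comp f | f <- l].
have := sc l'.
have -> : \sum_(f <- l')
      \sum_(x <- s) nrm (f x) `^ q =
    a^-1 `^ q * \sum_(f <- l) \sum_(x <- map S s) nrm (f x) `^ q.
  rewrite big_map mulr_sumr; apply: eq_bigr => f _; rewrite big_map mulr_sumr.
  by apply: eq_bigr => x _; rewrite pE.
have aK : a `^ q * a^-1 `^ q = 1.
  by rewrite -powRM ?invr_ge0 ?ltW// divff ?gt_eqF// powR1.
move=> H; rewrite powRM ?(ltW a0)// -[leLHS]mul1r -aK -mulrA.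
rewrite ler_wpM2l ?powR_ge0// H// => x; rewrite big_map.
under eq_bigr do rewrite pE.
rewrite -mulr_sumr (le_trans (ler_wpM2l (powR_ge0 _ _) (lq (S x))))//.
rewrite -powRM ?invr_ge0 ?nrm_ge0 ?(ltW a0)//; apply: ler_powR_nneg; first lra.
  by rewrite mulr_ge0 ?invr_ge0 ?nrm_ge0 ?(ltW a0).
by rewrite ler_pdivrMl.
Qed.

Lemma strong_le_map V W (S : V -> W) (a : R) q (s : seq V) (c : R) :
  (1 <= q)%E -> 0 <= a -> 0 <= c -> (forall x, nrm (S x) <= a * nrm x) ->
  strong_le q s c -> strong_le q (map S s) (a * c).
Proof.
case: q => [q||]//=; last first.
  move=> _ a0 c0 Sa sc _ /mapP[x xs ->].
  by rewrite (le_trans (Sa x))// ler_wpM2l// sc.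
rewrite lee_fin => q1 a0 c0 Sa sc; rewrite big_map powRM//.
apply: le_trans (ler_wpM2l (powR_ge0 _ _) sc).
rewrite mulr_sumr; apply: ler_sum => x _; rewrite -powRM ?nrm_ge0//.
by apply: ler_powR_nneg; rewrite ?nrm_ge0//; lra.
Qed.

(** The [q]-th powers of the two bounds are [A] and [B], which add up; for an infinite exponent all
    three bounds are 1. *)
Lemma mid_le_cat V q (s t : seq V) (A B : R) : (1 <= q)%E -> 0 <= A -> 0 <= B ->
  mid_le q s (eroot q A) -> mid_le q t (eroot q B) ->
  mid_le q (s ++ t) (eroot q (A + B)).
Proof.
case: q => [q q1 A0 B0 sA tB l lq|_ _ _ sA tB x|//]; last first.
  by rewrite mem_cat => /orP[/sA|/tB].
rewrite lee_fin in q1; have q0 : q != 0 by lra.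
under eq_bigr do rewrite big_cat.
rewrite big_split /= powRVK ?addr_ge0//; apply: lerD.
  by rewrite -[leRHS](powRVK q0)// sA.
by rewrite -[leRHS](powRVK q0)// tB.
Qed.

Lemma strong_le_cat V q (s t : seq V) (A B : R) : (1 <= q)%E -> 0 <= A -> 0 <= B ->
  strong_le q s (eroot q A) -> strong_le q t (eroot q B) ->
  strong_le q (s ++ t) (eroot q (A + B)).
Proof.
case: q => [q q1 A0 B0|_ _ _ sA tB x|//]; last first.
  by rewrite mem_cat => /orP[/sA|/tB].
rewrite lee_fin in q1; have q0 : q != 0 by lra.
rewrite /strong_le/= big_cat !powRVK ?addr_ge0//; exact: lerD.
Qed.

Lemma strong_le_finite V q (s : seq V) : (1 <= q)%E ->
  exists2 c : R, 0 <= c & strong_le q s c.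
Proof.
case: q => [q||]//=.
  rewrite lee_fin => q1; have q0 : q != 0 by lra.
  exists ((\sum_(x <- s) nrm x `^ q) `^ q^-1); first exact: powR_ge0.
  by rewrite powRVK// sumr_ge0// => x _; exact: powR_ge0.
move=> _; exists (\sum_(x <- s) nrm x); first by apply: sumr_ge0 => x _; exact: nrm_ge0.
move=> x xs; rewrite (big_rem x)//= lerDl.
by apply: sumr_ge0 => y _; exact: nrm_ge0.
Qed.

(** Exchange the two sums and use the weak bound at each point of the family. *)
Lemma strong_le_mid_le V q (s : seq V) (c : R) : strong_le q s c -> mid_le q s c.
Proof.
case: q => [q||]//= sc l lq; apply: le_trans sc; rewrite exchange_big/=.
by apply: ler_sum => x _; exact: lq.
Qed.

Lemma strong_le1 V q (x : V) : (1 <= q)%E -> strong_le q [:: x] (nrm x).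
Proof.
case: q => [q||]//=; first by rewrite big_seq1.
by move=> _ y; rewrite inE => /eqP ->.
Qed.

Lemma sup_norm_ge0 V (z : nat -> V) :
  (0 <= ereal_sup (range (fun j => enrm (z j))))%E.
Proof.
apply: (@le_trans _ _ (enrm (z 0%N))); first by rewrite lee_fin nrm_ge0.
by apply: ereal_sup_ubound; exists 0%N.
Qed.

Lemma strong_norm_ge0 V q (z : nat -> V) : (0 <= strong_norm q z)%E.
Proof. by case: q => [q||]; [exact: poweR_ge0|exact: sup_norm_ge0..]. Qed.

Lemma mid_norm_ge0 V q (z : nat -> V) : (1 <= q)%E -> (0 <= mid_norm q z)%E.
Proof.
case: q => [q q1|_|//]; last exact: sup_norm_ge0.
pose f : nat -> dual V := zero_extend [::].
apply: (@le_trans _ _ ((\sum_(0 <= n <oo) \sum_(0 <= j <oo)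
  (nrm (f n (z j)) `^ q)%:E) `^ q^-1)%E); first exact: poweR_ge0.
apply: ereal_sup_ubound; exists f => //; apply: weak_le1_norm => // x.
by rewrite big_nil powR_ge0.
Qed.

Lemma strong_norm_fin V q (s : seq V) : (1 <= q)%E ->
  exists c : R, [/\ 0 <= c, strong_norm q (zero_extend s) = c%:E & strong_le q s c].
Proof.
move=> q1; have [c c0 sc] := strong_le_finite s q1.
have := strong_norm_ge0 q (zero_extend s).
have /(strong_normP s q1 c0) := sc.
case E : (strong_norm q _) => [d||]// _; rewrite lee_fin => d0.
by exists d; split => //; apply/(strong_normP s q1 d0); rewrite E.
Qed.

Lemma mid_norm_fin V q (s : seq V) : (1 <= q)%E ->
  exists c : R, [/\ 0 <= c, mid_norm q (zero_extend s) = c%:E & mid_le q s c].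
Proof.
move=> q1; have [c c0 /strong_le_mid_le sc] := strong_le_finite s q1.
have := mid_norm_ge0 (zero_extend s) q1.
have /(mid_normP s q1 c0) := sc.
case E : (mid_norm q _) => [d||]// _; rewrite lee_fin => d0.
by exists d; split => //; apply/(mid_normP s q1 d0); rewrite E.
Qed.

End finite_families.

(** * Norm inequalities *)

Section elem_tensor.
Context {K : fieldType} (X Y : lmodType K).

Lemma elem_tensorDl (x x' : X) (y : Y) : (x + x') ⊗ y = x ⊗ y + x' ⊗ y.
Proof. by apply: val_inj; apply/funext => A /=; rewrite linearDl. Qed.

Lemma elem_tensorDr (x : X) (y y' : Y) : x ⊗ (y + y') = x ⊗ y + x ⊗ y'.
Proof. by apply: val_inj; apply/funext => A /=; rewrite linearDr. Qed.

Lemma elem_tensorZl (a : K) (x : X) (y : Y) : (a *: x) ⊗ y = a *: (x ⊗ y).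
Proof. by apply: val_inj; apply/funext => A /=; rewrite linearZl_LR. Qed.

Lemma elem_tensorZr (a : K) (x : X) (y : Y) : x ⊗ (a *: y) = a *: (x ⊗ y).
Proof. by apply: val_inj; apply/funext => A /=; rewrite linearZr_LR. Qed.

End elem_tensor.

(** * [gamma] as a norm between the injective and projective norms *)

Section gamma_norm.
Context {R : realType} {k : scalar_kind}.
Local Notation K := (scalar_field R k).
Local Notation banach := (completeNormedModType K).
Variable p : \bar R.
Hypothesis p1 : (1 <= p)%E.
Local Notation q := (hoelder_conjugate p).
Let q1 : (1 <= q)%E := hoelder_conjugate_ge1 p1.
Local Notation gamma X Y := (@gamma R k p X Y).

Lemma gamma_le (X Y : banach) (s : seq (X * Y)) (m c : R) : 0 <= m -> 0 <= c ->
  mid_le q (unzip1 s) m -> strong_le p (unzip2 s) c ->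
  (gamma X Y (\sum_(z <- s) z.1 ⊗ z.2)%R <= (m * c)%:E)%E.
Proof.
move=> m0 c0 /(mid_normP _ q1 m0) sm /(strong_normP _ p1 c0) sc.
apply: le_trans (_ : (_ * _ <= _)%E).
  by apply: ereal_inf_lbound; exists s.
by rewrite EFinM lee_pmul// ?mid_norm_ge0 ?strong_norm_ge0.
Qed.

Lemma le_gamma (X Y : banach) (u : tensor X Y) (r : \bar R) :
  (forall (s : seq (X * Y)) (m c : R), u = \sum_(z <- s) z.1 ⊗ z.2 ->
    0 <= m -> 0 <= c -> mid_le q (unzip1 s) m -> strong_le p (unzip2 s) c ->
    (r <= (m * c)%:E)%E) ->
  (r <= gamma X Y u)%E.
Proof.
move=> H; apply: le_ereal_inf_tmp => _ [s /= us <-].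
have [m [m0 -> sm]] := mid_norm_fin (unzip1 s) q1.
have [c [c0 -> sc]] := strong_norm_fin (unzip2 s) p1.
by rewrite -EFinM; exact: H us m0 c0 sm sc.
Qed.

Lemma gamma_ge0 (X Y : banach) (u : tensor X Y) : (0 <= gamma X Y u)%E.
Proof. by apply: le_gamma => s m c _ m0 c0 _ _; rewrite lee_fin mulr_ge0. Qed.

(* A representation whose mid and strong norms balance an upper bound [A] of the
   product; balanced representations of [u] and [v] concatenate to one of [u + v]. *)
Definition balanced (X Y : banach) (s : seq (X * Y)) (A : R) : Prop :=
  mid_le q (unzip1 s) (eroot q A) /\ strong_le p (unzip2 s) (eroot p A).

Lemma gamma_balanced_le (X Y : banach) (s : seq (X * Y)) (A : R) : 0 <= A ->
  balanced s A -> (gamma X Y (\sum_(z <- s) z.1 ⊗ z.2)%R <= A%:E)%E.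
Proof.
move=> A0 [sm sc]; rewrite -[X in X%:E](eroot_conjugate p1 A0).
by apply: gamma_le => //; exact: eroot_ge0.
Qed.

(** Multiplying the first components by [t] and the second ones by [1 / t] changes neither the
    tensor nor the product of the bounds, so a suitable [t] balances them. *)
Lemma gamma_lt_balanced (X Y : banach) (u : tensor X Y) (A : R) : 0 < A ->
  (gamma X Y u < A%:E)%E ->
  exists2 s : seq (X * Y), u = \sum_(z <- s) z.1 ⊗ z.2 & balanced s A.
Proof.
move=> A0 uA; have [s [m [c [-> [m0 c0] sm sc mcA]]]] : exists (s : seq (X * Y)) (m c : R),
    [/\ u = \sum_(z <- s) z.1 ⊗ z.2, 0 <= m /\ 0 <= c,
      mid_le q (unzip1 s) m, strong_le p (unzip2 s) c & m * c < A].
  apply: contrapT => H; move: uA; apply/negP; rewrite -leNgt; apply: le_gamma.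
  move=> s m c us m0 c0 sm sc; rewrite lee_fin leNgt; apply/negP => mcA.
  by apply: H; exists s, m, c.
have rq0 := eroot_gt0 q A0; have rp0 := eroot_gt0 p A0.
have rA := eroot_conjugate p1 (ltW A0).
have [t [t0 tm tc]] : exists t : R, [/\ 0 < t, t * m <= eroot q A &
    t^-1 * c <= eroot p A].
  (* If [m = 0], any large [t] will do; the summand 1 keeps it positive when [c = 0]. *)
  move: m0; rewrite le_eqVlt => /predU1P[<-|m0].
    exists (c / eroot p A + 1); split.
    - by rewrite ltr_wpDl// divr_ge0// ltW.
    - by rewrite mulr0 ltW.
    rewrite mulrC ler_pdivrMr; last by rewrite ltr_wpDl// divr_ge0// ltW.
    by rewrite mulrDr mulr1 mulrCA divff ?gt_eqF// mulr1 lerDl ltW.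
  (* This [t] makes the first bound an equality and leaves the slack in [m * c < A] to the
     second. *)
  exists (eroot q A / m); split; first by rewrite divr_gt0.
    by rewrite divfK// gt_eqF.
  rewrite invf_div mulrAC ler_pdivrMr// mulrC [leRHS]mulrC rA.
  by rewrite mulrC ltW.
exists [seq (scal_real k t *: z.1, scal_real k t^-1 *: z.2) | z <- s].
  rewrite big_map; apply: eq_bigr => z _ /=.
  rewrite elem_tensorZl elem_tensorZr scalerA -scal_realM divff ?gt_eqF//.
  by rewrite scal_real1 scale1r.
have t0' := ltW t0; have tV0 : 0 <= t^-1 by rewrite invr_ge0.
split.
  rewrite /unzip1 -map_comp (map_comp (fun x => scal_real k t *: x) fst).
  apply: (mid_leW q1 _ tm); first by rewrite mulr_ge0.
  apply: (@mid_le_map _ _ _ _ (GRing.scale (scal_real k t))) => // x.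
  by rewrite nrmZ nrm_scal_real.
rewrite /unzip2 -map_comp (map_comp (fun x => scal_real k t^-1 *: x) snd).
apply: (strong_leW p1 _ tc); first by rewrite mulr_ge0.
apply: strong_le_map => // x.
by rewrite nrmZ nrm_scal_real.
Qed.

Lemma gamma_elem (X Y : banach) (x : X) (y : Y) :
  (gamma X Y (x ⊗ y) <= (nrm x * nrm y)%:E)%E.
Proof.
have -> : x ⊗ y = \sum_(z <- [:: (x, y)]) z.1 ⊗ z.2 by rewrite big_seq1.
by apply: gamma_le; rewrite ?nrm_ge0//; [apply: strong_le_mid_le|];
  exact: strong_le1.
Qed.

Lemma gamma_fin (X Y : banach) (u : tensor X Y) : exists a, gamma X Y u = a%:E.
Proof.
have := gamma_ge0 u; case E : (gamma X Y u) => [a||]// _; first by exists a.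
have [s us] := tensorP u.
have [m [m0 _ sm]] := mid_norm_fin (unzip1 s) q1.
have [c [c0 _ sc]] := strong_norm_fin (unzip2 s) p1.
by have := gamma_le m0 c0 sm sc; rewrite -us E.
Qed.

Lemma lee_gamma (X Y : banach) (u : tensor X Y) (r : \bar R) :
  (forall A : R, 0 < A -> (gamma X Y u < A%:E)%E -> (r <= A%:E)%E) ->
  (r <= gamma X Y u)%E.
Proof.
have := gamma_ge0 u; case E : (gamma X Y u) => [a||]//; last by move=> _ _; rewrite leey.
rewrite lee_fin => a0 H; apply/lee_addgt0Pr => e e0.
by apply: H; rewrite ?lte_fin; lra.
Qed.

Lemma gammaD (X Y : banach) (u v : tensor X Y) :
  (gamma X Y (u + v)%R <= gamma X Y u + gamma X Y v)%E.
Proof.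
apply/lee_addgt0Pr => e e0.
have [a aE] := gamma_fin u; have [b bE] := gamma_fin v.
rewrite aE bE -!EFinD.
have a0 : 0 <= a by rewrite -lee_fin -aE gamma_ge0.
have b0 : 0 <= b by rewrite -lee_fin -bE gamma_ge0.
(* The summands [e / 2] give bounds that are strict and positive even where [gamma] vanishes, as
   balancing requires. *)
have [||s -> sA] := @gamma_lt_balanced _ _ u (a + e / 2); [lra|by rewrite aE lte_fin; lra|].
have [||t -> tB] := @gamma_lt_balanced _ _ v (b + e / 2); [lra|by rewrite bE lte_fin; lra|].
rewrite -big_cat (_ : a + b + e = (a + e / 2) + (b + e / 2)); last by field.
apply: gamma_balanced_le; first lra.
case: sA tB => [sm sc] [tm tc]; split.
  by rewrite /unzip1 map_cat; apply: mid_le_cat => //; lra.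
by rewrite /unzip2 map_cat; apply: strong_le_cat => //; lra.
Qed.

Lemma gamma_map (X1 X2 Y1 Y2 : banach) (S1 : {linear X1 -> Y1})
    (S2 : {linear X2 -> Y2}) (a b : R) (u : tensor X1 X2) : 0 <= a -> 0 <= b ->
  (forall x, nrm (S1 x) <= a * nrm x) -> (forall x, nrm (S2 x) <= b * nrm x) ->
  (gamma Y1 Y2 (tensor_map S1 S2 u) <= (a * b)%:E * gamma X1 X2 u)%E.
Proof.
move=> a0 b0 Sa Sb.
have H (s : seq (X1 * X2)) (m c : R) : u = \sum_(z <- s) z.1 ⊗ z.2 ->
    0 <= m -> 0 <= c -> mid_le q (unzip1 s) m -> strong_le p (unzip2 s) c ->
    (gamma Y1 Y2 (tensor_map S1 S2 u) <= ((a * b) * (m * c))%:E)%E.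
  move=> -> m0 c0 sm sc.
  have -> : tensor_map S1 S2 (\sum_(z <- s) z.1 ⊗ z.2) =
      \sum_(z <- [seq (S1 z.1, S2 z.2) | z <- s]) z.1 ⊗ z.2.
    by rewrite linear_sum big_map; apply: eq_bigr => z _; exact: tensor_map_elem.
  rewrite mulrACA; apply: gamma_le; rewrite ?mulr_ge0//.
    rewrite /unzip1 -map_comp (map_comp S1 fst); exact: mid_le_map.
  rewrite /unzip2 -map_comp (map_comp S2 snd); exact: strong_le_map.
(* A single representation settles [a * b = 0]; otherwise divide by [a * b] to pass to the
   infimum. *)
have [ab0|ab0] := eqVneq (a * b) 0.
  rewrite ab0 mul0e; have [s us] := tensorP u.
  have [m [m0 _ sm]] := mid_norm_fin (unzip1 s) q1.
  have [c [c0 _ sc]] := strong_norm_fin (unzip2 s) p1.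
  by have := H _ _ _ us m0 c0 sm sc; rewrite ab0 mul0r.
have {}ab0 : 0 < a * b by rewrite lt_neqAle eq_sym ab0 mulr_ge0.
rewrite -lee_pdivrMl//; apply: le_gamma => s m c us m0 c0 sm sc.
by rewrite lee_pdivrMl// -EFinM; exact: H us m0 c0 sm sc.
Qed.

Lemma gamma0 (X Y : banach) : gamma X Y 0 = 0%E.
Proof.
apply/eqP; rewrite eq_le gamma_ge0 andbT.
by have := gamma_elem (0 : X) (0 : Y); rewrite -(scale0r 0) elem_tensorZl !scale0r nrm0 mul0r.
Qed.

Lemma gammaZ_le (X Y : banach) (a : K) (u : tensor X Y) :
  (gamma X Y (a *: u)%R <= (nrm (a : K^o))%:E * gamma X Y u)%E.
Proof.
(* Scaling by [a] is the tensor map of [a] times the identity on [X] and the identity on [Y]. *)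
have -> : a *: u = tensor_map (GRing.scale a : {linear X -> X}) (idfun : {linear Y -> Y}) u.
  have [s ->] := tensorP u; rewrite scaler_sumr [RHS]linear_sum; apply: eq_bigr => z _.
  rewrite -elem_tensorZl; exact: val_inj.
rewrite -[nrm _]mulr1; apply: gamma_map => //; first exact: nrm_ge0.
  by move=> x; rewrite nrmZ.
by move=> y; rewrite mul1r.
Qed.

Lemma gammaZ (X Y : banach) (a : K) (u : tensor X Y) :
  (gamma X Y (a *: u)%R = (nrm (a : K^o))%:E * gamma X Y u)%E.
Proof.
have [->|a0] := eqVneq a 0; first by rewrite scale0r gamma0 nrm0 mul0e.
apply/eqP; rewrite eq_le gammaZ_le/=.
have na0 : nrm (a : K^o) != 0 by apply: contra_neq a0; exact: nrm0_eq0.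
have na : 0 < nrm (a : K^o) by rewrite lt_neqAle eq_sym na0 nrm_ge0.
rewrite -lee_pdivlMl//; have := gammaZ_le a^-1 (a *: u).
by rewrite scalerK// nrmV.
Qed.

Lemma gamma_le_projective (X Y : banach) (u : tensor X Y) :
  (gamma X Y u <= projective_norm u)%E.
Proof.
apply: le_ereal_inf_tmp => _ [s /= -> <-].
elim: s => [|z s IH]; first by rewrite !big_nil gamma0.
rewrite !big_cons EFinD (le_trans (gammaD _ _))//.
by apply: leeD => //; exact: gamma_elem.
Qed.

Lemma injective_le_gamma (X Y : banach) (u : tensor X Y) :
  (injective_norm u <= gamma X Y u)%E.
Proof.
apply: ge_ereal_sup => _ [f [g [f1 g1 ->]]]; apply: lee_gamma => A A0.
move=> /(gamma_lt_balanced A0)[s -> [sm sc]].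
rewrite /enrm lee_fin sum_elem_tensorE /formal_sum (le_trans (nrm_sum _ _ _))//.
have fx x : nrm (f x) <= nrm x.
  by rewrite (le_trans (nrm_dual_apply f x))// ler_piMl// nrm_ge0.
have gy y : nrm (g y) <= nrm y.
  by rewrite (le_trans (nrm_dual_apply g y))// ler_piMl// nrm_ge0.
rewrite (eq_bigr (fun z => nrm (f z.1) * nrm (g z.2))); last first.
  by move=> z _; exact: (nrmM (f z.1) (g z.2)).
(* The one-element family of [f] is an admissible test for the mid norm. *)
have fw r : 0 <= r -> weak_le1 r [:: f].
  by move=> r0 x; rewrite big_seq1; apply: ler_powR_nneg => //; exact: nrm_ge0.
move: sm sc; have A0' := ltW A0.
have powRVK1 (r : R) : 1 < r -> (A `^ r^-1) `^ r = A.
  by move=> r1; rewrite powRVK//; lra.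
have root1 : (A `^ 1^-1) `^ 1 = A by rewrite invr1 !powRr1// powR_ge0.
(* At [p = 1] and [p = +oo] one factor is at most 1 and the other sums to at most [A]; in between,
   Young's inequality gives [A / t + A / r = A]. *)
case: (hoelder_conjugate_ge1P p1) => [sm|sm sc|r t r1 t1 rt sm sc] /=.
- rewrite root1 => sc; apply: le_trans sc; rewrite /unzip2 big_map.
  rewrite big_seq [leRHS]big_seq; apply: ler_sum => z zs.
  rewrite powRr1 ?nrm_ge0// (le_trans _ (gy _))// ler_piMl ?nrm_ge0//.
  by rewrite (le_trans (fx _))// sm// map_f.
- have := sm [:: f] (fw 1 ler01); rewrite root1 big_seq1 => H; apply: (le_trans _ H).
  rewrite /unzip1 big_map big_seq [leRHS]big_seq; apply: ler_sum => z zs.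
  rewrite powRr1 ?nrm_ge0// ler_piMr ?nrm_ge0//.
  by rewrite (le_trans (gy _))// sc// map_f.
have t0 : 0 <= t by lra.
have := sm [:: f] (fw t t0); rewrite powRVK1// big_seq1 /unzip1 big_map => fA.
move: sc; rewrite /strong_le/= powRVK1// /unzip2 big_map => gA.
apply: (@le_trans _ _ (\sum_(z <- s) (nrm (f z.1) `^ t / t + nrm z.2 `^ r / r))).
  apply: ler_sum => z _; rewrite (le_trans (ler_wpM2l (nrm_ge0 (f z.1)) (gy z.2)))//.
  by apply: conjugate_powR; rewrite ?nrm_ge0//; lra.
rewrite big_split/= -!mulr_suml -[leRHS]mulr1 -rt addrC mulrDr.
by apply: lerD; rewrite ler_wpM2r// invr_ge0; lra.
Qed.

End gamma_norm.

(** * Hahn-Banach theorem and definiteness *)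

Lemma scal_realN1 (R : realType) (k : scalar_kind) :
  scal_real k (-1 : R) = -1.
Proof. by case: k => //=; rewrite rmorphN1. Qed.

Section hahn_banach.
Context {R : realType} {k : scalar_kind}.
Local Notation K := (scalar_field R k).
Variables (V : lmodType K) (p : V -> R).
Local Notation rscale r x := (scal_real k (r : R) *: (x : V)).
Hypothesis pD : forall x y, p (x + y) <= p x + p y.
Hypothesis pZ : forall r x, 0 < r -> p (rscale r x) = r * p x.

(** Partial real-linear functionals are given by their graphs. Chains are then merged by plain
    unions, and domination by [p] makes a linear graph single-valued. *)
Let rlinear (G : set (V * R)) := forall r a b, G a -> G b ->
  G (rscale r a.1 + b.1, r * a.2 + b.2).
Let dominated (G : set (V * R)) := forall a, G a -> a.2 <= p a.1.

(** Extension by one vector: the value [c] at [y] is the supremum of the lower bounds imposed by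
    domination, and subadditivity of [p] keeps these below all the upper bounds. *)
Lemma hahn_banach_extension (G : set (V * R)) (y : V) :
  rlinear G -> dominated G -> G (0, 0) ->
  exists2 H : set (V * R), G `<=` H /\ (exists c, H (y, c)) &
    rlinear H /\ dominated H.
Proof.
move=> Gl Gd G00.
pose L := [set a.2 - p (a.1 - y) | a in G].
have Lub (b : V * R) : G b -> ubound L (p (b.1 + y) - b.2).
  move=> Gb _ [a Ga <-].
  have := Gd _ (Gl 1 _ _ Ga Gb); rewrite /= scal_real1 scale1r mul1r.
  have := pD (a.1 - y) (b.1 + y); rewrite addrACA addNr addr0.
  by lra.
pose c := sup L.
have c_ge a : G a -> a.2 - p (a.1 - y) <= c.
  move=> Ga; apply: ub_le_sup; last by exists a.
  by exists (p (0 + y) - 0); exact: (Lub _ G00).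
have c_le b : G b -> c <= p (b.1 + y) - b.2.
  by move=> Gb; apply: ge_sup; [exists (0 - p (0 - y)), (0, 0)|exact: Lub].
exists [set (ar.1.1 + rscale ar.2 y, ar.1.2 + ar.2 * c) | ar in
    [set ar : (V * R) * R | G ar.1]].
  split=> [a Ga|].
    by exists (a, 0) => //=; rewrite scal_real0 scale0r mul0r !addr0; case: a {Ga}.
  by exists c, ((0, 0), 1) => //=; rewrite scal_real1 scale1r mul1r !add0r.
have GZ r a : G a -> G (rscale r a.1, r * a.2).
  by move=> Ga; have := Gl r _ _ Ga G00; rewrite /= !addr0.
split=> [r _ _ [[a s]/= Ga <-] [[b t]/= Gb <-]|_ [[a r]/= Ga <-]].
  exists ((rscale r a.1 + b.1, r * a.2 + b.2), r * s + t); first exact: Gl.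
  rewrite /= scal_realD scal_realM scalerDl scalerDr scalerA; congr (_, _).
    by rewrite addrACA.
  by ring.
have [->|rN0] := eqVneq r 0.
  by rewrite /= scal_real0 scale0r mul0r !addr0; exact: Gd.
(* Dividing by [|r|] reduces to the coefficients -1 and 1 of [y], governed by the lower and the
   upper bounds on [c]. *)
have [r0|r0] := ltP r 0.
  have r0' : 0 < - r by rewrite oppr_gt0.
  have := c_ge _ (GZ (- r)^-1 a Ga); rewrite /=.
  have -> : a.1 + rscale r y = rscale (- r) (rscale (- r)^-1 a.1 - y).
    rewrite scalerBr scalerA -scal_realM divff ?gt_eqF// scal_real1 scale1r.
    by rewrite -scalerN -scaleN1r scalerA -scal_realN1 -scal_realM mulrN1 opprK.
  rewrite pZ// lerBlDr -(ler_pM2l r0') mulrDr mulrA divff ?gt_eqF// mul1r.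
  by lra.
have {}r0 : 0 < r by rewrite lt_neqAle eq_sym rN0.
have := c_le _ (GZ r^-1 a Ga); rewrite /=.
have -> : a.1 + rscale r y = rscale r (rscale r^-1 a.1 + y).
  by rewrite scalerDr scalerA -scal_realM divff ?gt_eqF// scal_real1 scale1r.
rewrite pZ// lerBrDr -(ler_pM2l r0) mulrDr mulrA divff ?gt_eqF// mul1r.
by lra.
Qed.

Lemma hahn_banach (G0 : set (V * R)) :
  rlinear G0 -> dominated G0 -> G0 (0, 0) ->
  exists u : V -> R, [/\ forall r x y, u (rscale r x + y) = r * u x + u y,
    forall x, u x <= p x & forall a, G0 a -> u a.1 = a.2].
Proof.
move=> G0l G0d G00.
(* [G0] is adjoined inside [P] so that the empty set, the union of the empty chain, satisfies
   [P]. *)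
pose P (A : set (V * R)) := rlinear (A `|` G0) /\ dominated (A `|` G0).
have [F FP Ftot|A [[Gl Gd] Amax]] := @Zorn_bigcup _ P.
  have cover a b : (\bigcup_(X in F) X `|` G0) a -> (\bigcup_(X in F) X `|` G0) b ->
      exists2 B : set (V * R), P B & B `<=` (\bigcup_(X in F) X) `|` G0 /\
        (B `|` G0) a /\ (B `|` G0) b.
    have P0 : P set0 by rewrite /P set0U.
    move=> [[A FA Aa]|G0a] [[B FB Bb]|G0b].
    - have [AB|BA] := Ftot _ _ FA FB.
        exists B; first exact: FP.
        by split=> [x Bx|]; [left; exists B|split; left => //; exact: AB].
      exists A; first exact: FP.
      by split=> [x Bx|]; [left; exists A|split; left => //; exact: BA].
    - exists A; first exact: FP.
      by split=> [x Bx|]; [left; exists A|split; [left|right]].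
    - exists B; first exact: FP.
      by split=> [x Bx|]; [left; exists B|split; [right|left]].
    - by exists set0 => //; split=> //; split; right.
  split=> [r a b Ha Hb|a Ha].
    have [B [Bl _] [BF [Ba Bb]]] := cover _ _ Ha Hb.
    by have [/BF|] := Bl r _ _ Ba Bb; [|right].
  by have [B [_ Bd] [_ [Ba _]]] := cover _ _ Ha Ha; exact: Bd.
pose G := A `|` G0.
have G0' : G (0, 0) by right.
have tot y : exists r, G (y, r).
  apply: contrapT => nG.
  have [H [GH [c Hc]] [Hl Hd]] := hahn_banach_extension y Gl Gd G0'.
  apply: (Amax H).
    split; first by move=> x Ax; apply: GH; left.
    by move=> HA; apply: nG; exists c; left; exact: HA.
  by rewrite /P setUidl// => x G0x; apply: GH; right.
have p0 : p 0 = 0.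
  by have := pZ 0 (ltr0Sn R 1); rewrite scaler0; lra.
(* The difference of two values at [y] is a value at 0, hence at most [p 0 = 0]. *)
have uniq y r s : G (y, r) -> G (y, s) -> r <= s.
  move=> Gr Gs; have := Gd _ (Gl (-1) _ _ Gs Gr).
  by rewrite /= scal_realN1 scaleN1r addNr p0; lra.
pose u y := projT1 (cid (tot y)).
have uG y : G (y, u y) by exact: (projT2 (cid (tot y))).
have uE y r : G (y, r) -> u y = r.
  by move=> Gr; apply/eqP; rewrite eq_le !(uniq y).
exists u; split=> [r x y|x|[x r] G0x].
- exact: (uE _ _ (Gl r _ _ (uG x) (uG y))).
- exact: Gd (uG x).
- by apply: uE; right.
Qed.

End hahn_banach.

Section separation.
Context {R : realType}.

Lemma scal_re_mul (k : scalar_kind) (r : R) (a : scalar_field R k) :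
  scal_re (scal_real k r * a) = r * scal_re a.
Proof. by case: k a => //= -[a b] /=; rewrite mul0r subr0. Qed.

Lemma scal_re_le_nrm (k : scalar_kind) (a : scalar_field R k) :
  scal_re a <= nrm (a : (scalar_field R k)^o).
Proof.
case: k a => a; first exact: ler_norm.
rewrite -(@le_scal_real R ComplexScalars) nrmE (le_trans _ (normc_ge_Re a))//.
by rewrite lecR ler_norm.
Qed.

Lemma nrm_scal_realE (k : scalar_kind) (r : R) :
  nrm (scal_real k r : (scalar_field R k)^o) = `|r|.
Proof.
have [r0|r0] := ger0P r; first exact: nrm_scal_real.
rewrite -nrmN (_ : - scal_real k r = scal_real k (- r)); last first.
  by rewrite -[in RHS]mulN1r scal_realM scal_realN1 mulN1r.
by rewrite nrm_scal_real// oppr_ge0 ltW.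
Qed.

Lemma nrm_complex_i :
  nrm (Complex 0 1 : (scalar_field R ComplexScalars)^o) = 1.
Proof.
have : nrm (Complex 0 1 : (scalar_field R ComplexScalars)^o) ^+ 2 = 1.
  rewrite expr2 -(@nrmM R ComplexScalars) (_ : Complex 0 1 * Complex 0 1 = -1).
    by rewrite (@nrmN R ComplexScalars) (@nrm1 R ComplexScalars).
  by simpc.
by move=> /eqP; rewrite sqrp_eq1 ?nrm_ge0// => /eqP.
Qed.

Lemma nrm_complex_le (z : scalar_field R ComplexScalars) :
  nrm (z : (scalar_field R ComplexScalars)^o) <=
    `|complex.Re z| + `|complex.Im z|.
Proof.
rewrite [X in nrm X](_ : _ = scal_real ComplexScalars (complex.Re z) +
    scal_real ComplexScalars (complex.Im z) * Complex 0 1); last first.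
  by case: z => a b /=; simpc.
rewrite (le_trans (@nrmD R ComplexScalars _ _ _))//.
by rewrite (@nrmM R ComplexScalars) !nrm_scal_realE nrm_complex_i mulr1.
Qed.

Lemma norm_Re_le_nrm (z : scalar_field R ComplexScalars) :
  `|complex.Re z| <= nrm (z : (scalar_field R ComplexScalars)^o).
Proof.
rewrite ler_norml lerNl (scal_re_le_nrm z) andbT -nrmN.
by apply: le_trans (scal_re_le_nrm _); case: z.
Qed.

Lemma norm_Im_le_nrm (z : scalar_field R ComplexScalars) :
  `|complex.Im z| <= nrm (z : (scalar_field R ComplexScalars)^o).
Proof.
have := norm_Re_le_nrm (Complex 0 1 * z).
rewrite (@nrmM R ComplexScalars) nrm_complex_i mul1r; apply: le_trans.
by case: z => a b /=; rewrite mul0r mul1r sub0r normrN.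
Qed.

(* Over the complex numbers a functional is recovered from its real part [u] as
   [u x - i u (i x)]. *)
Lemma dual_of_real_part (k : scalar_kind) (V : normedModType (scalar_field R k))
    (u : V -> R) (C : R) :
  (forall r x y, u (scal_real k r *: x + y) = r * u x + u y) ->
  (forall x, u x <= C * nrm x) ->
  exists f : dual V, forall x, scal_re (f x) = u x.
Proof.
move=> ul uC.
have u0 : u 0 = 0 by have := ul 1 0 0; rewrite scaler0 addr0; lra.
have uZ r x : u (scal_real k r *: x) = r * u x.
  by have := ul r x 0; rewrite !addr0 u0 addr0.
have uD x y : u (x + y) = u x + u y.
  by have := ul 1 x y; rewrite scal_real1 scale1r mul1r.
have uB x : `|u x| <= C * nrm x.
  rewrite ler_norml uC andbT lerNl -mulN1r -uZ (le_trans (uC _))//.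
  by rewrite scal_realN1 scaleN1r nrmN.
case: k V u ul uC u0 uZ uD uB => V u ul uC u0 uZ uD uB.
  by have [f fE] := @dual_of_bounded R RealScalars V u C ul uB; exists f.
pose j : R[i] := Complex 0 1.
have uC' (a b : R) x : u (Complex a b *: x : V) = a * u x + b * u (j *: x).
  have -> : Complex a b =
      scal_real ComplexScalars a + scal_real ComplexScalars b * j :> R[i].
    by rewrite /j /=; simpc.
  by rewrite scalerDl -scalerA uD !uZ.
pose F (x : V) : R[i] := Complex (u x) (- u (j *: x)).
have Fl : @GRing.linear_for R[i] V R[i]^o *:%R F.
  move=> [a b] x y; rewrite /F scalerDr !uD uC'.
  have -> : j *: (Complex a b *: x : V) = Complex (- b) a *: x.
    by rewrite scalerA /j; congr (_ *: _); simpc.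
  rewrite (uC' (- b) a); move: (u x) (u (j *: x)) (u y) (u (j *: y)) => r s t v.
  rewrite [RHS]/GRing.add/= /GRing.scale/=; simpc.
  by congr Complex; ring.
have FB x : nrm (F x : (scalar_field R ComplexScalars)^o) <= C * 2 * nrm x.
  rewrite (le_trans (nrm_complex_le _))//= normrN.
  by have := uB x; have := uB (j *: x); rewrite nrmZ nrm_complex_i mul1r; lra.
have [f fE] := @dual_of_bounded R ComplexScalars V F (C * 2) Fl FB.
by exists f => x; rewrite fE.
Qed.

End separation.

(** * Separating a point from a finite span *)

Section span_separation.
Context {R : realType} {k : scalar_kind}.
Local Notation K := (scalar_field R k).
Variable V : normedModType K.

Lemma mem_span (s : seq V) x : x \in s -> span s x.
Proof.
elim: s => // y s IH; rewrite inE => /predU1P[->|/IH xs]; apply/span_cons.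
  by exists 1; rewrite scale1r subrr; exact: span0.
by exists 0; rewrite scale0r subr0.
Qed.

(** Finite spans are closed, so some ball around [y] misses the span; its radius serves as [d]. *)
Lemma span_dist (s : seq V) (y : V) : ~ span s y ->
  exists2 d : R, 0 < d & forall (a : K) m, span s m ->
    d * nrm (a : K^o) <= nrm (a *: y + m).
Proof.
move=> ys.
have : (~` span s) y by [].
have /open_nbhs_nbhs : open_nbhs y (~` span s).
  by split => //; exact/closed_openC/span_closed.
move=> /nbhs_normP[d/= d0 dy] _.
have dE : scal_real k (scal_re d) = d by rewrite scal_reK// ltW.
have {}d0 : 0 < scal_re d.
  rewrite lt_neqAle -(@le_scal_real R k) scal_real0 dE (ltW d0) andbT.
  by apply: contraTneq d0 => d0; rewrite -dE -d0 scal_real0 ltxx.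
have dist m : span s m -> scal_re d <= nrm (y - m).
  move=> sm; rewrite leNgt; apply/negP => ym; apply: (dy m) sm.
  by rewrite /= -nrmE -dE lt_neqAle le_scal_real (ltW ym) andbT;
    apply: contra_ltN ym => /eqP /scal_real_inj ->.
exists (scal_re d) => // a m sm; have [->|a0] := eqVneq a 0.
  by rewrite nrm0 mulr0 nrm_ge0.
rewrite mulrC -[m](scalerKV a0) -scalerDr nrmZ ler_wpM2l ?nrm_ge0//.
by rewrite -[_ *: m]opprK dist// -scaleNr; exact: spanZ.
Qed.

Lemma span_separation (s : seq V) (y : V) : ~ span s y ->
  exists f : dual V, f y = 1 /\ forall x, span s x -> f x = 0.
Proof.
move=> ys; have [d d0 dP] := span_dist ys.
(* The graph of [a *: y + m |-> Re a], dominated by the norm divided by [d]. *)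
pose G0 : set (V * R) := [set (am.1 *: y + am.2, scal_re am.1) |
  am in [set am : K * V | span s am.2]].
pose pp (x : V) := d^-1 * nrm x.
have ppD x z : pp (x + z) <= pp x + pp z.
  by rewrite -mulrDr ler_wpM2l ?nrmD// invr_ge0 ltW.
have ppZ (r : R) x : 0 < r -> pp (scal_real k r *: x) = r * pp x.
  by move=> r0; rewrite /pp nrmZ nrm_scal_real ?ltW// mulrCA.
have [||| u [ul up uE]] := @hahn_banach R k V pp ppD ppZ G0.
- move=> r _ _ [[a m]/= sm <-] [[b n]/= sn <-].
  exists (scal_real k r * a + b, scal_real k r *: m + n); first exact: span_lin.
  by rewrite /= scal_reD scal_re_mul scalerDl scalerDr scalerA addrACA.
- move=> _ [[a m]/= sm <-]; rewrite /pp ler_pdivlMl//.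
  by rewrite (le_trans _ (dP a m sm))// ler_pM2l// scal_re_le_nrm.
- exists (0, 0); rewrite /= ?scale0r ?addr0; first exact: span0.
  by rewrite -(@scal_real0 R k) scal_realK.
have [f fE] := dual_of_real_part ul up.
have fP a m : span s m -> scal_re (f (a *: y + m)) = scal_re a.
  by move=> sm; rewrite fE; apply: (uE (_, _)); exists (a, m).
have re1 : scal_re (1 : K) = 1 by rewrite -(@scal_real1 R k) scal_realK.
have re0 : scal_re (0 : K) = 0 by rewrite -(@scal_real0 R k) scal_realK.
(* Only the real part of [f] is known to vanish on the span; a nonzero [f x] is excluded by the
   point [(f x)^-1 *: x], where [f] is 1. *)
have f0 x : span s x -> f x = 0.
  move=> sx; apply: contrapT => /eqP fx0.
  have := fP 0 ((f x : K)^-1 *: x) (spanZ _ sx).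
  rewrite scale0r add0r linearZ_LR [X in scal_re X](_ : _ = (f x : K)^-1 * f x)//.
  rewrite mulVf// re1 re0 => /eqP.
  by rewrite oner_eq0.
have fy0 : (f y : K) != 0.
  apply/eqP => fy0; have := fP 1 0 (span0 _).
  by rewrite scale1r addr0 fy0 re1 re0 => /eqP; rewrite eq_sym oner_eq0.
exists ((f y : K)^-1 *: f : dual V); split=> [|x sx].
  by rewrite [LHS](_ : _ = (f y)^-1 * f y :> K)// mulVf.
by rewrite [LHS](_ : _ = (f y)^-1 * f x :> K)// (f0 x sx) mulr0.
Qed.

End span_separation.

Section injective_definite.
Context {R : realType} {k : scalar_kind}.
Local Notation K := (scalar_field R k).
Variables X Y : completeNormedModType K.

Lemma span_nth (V : normedModType K) (s : seq V) (x : V) : span s x ->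
  exists c : nat -> K, x = \sum_(0 <= i < size s) c i *: s`_i.
Proof. by move=> [c ->]; exists c; rewrite big_mkord. Qed.

(* Shorten the representation: either a first component lies in the span of the
   others and can be absorbed, or a functional isolating it kills its partner. *)
Lemma injective_separates (s : seq (X * Y)) :
  (forall (f : dual X) (g : dual Y), \sum_(z <- s) (f z.1 * g z.2 : K) = 0) ->
  \sum_(z <- s) z.1 ⊗ z.2 = 0.
Proof.
have [n] := ubnP (size s); elim: n s => // n IH [|[x y] t] /=.
  by rewrite big_nil.
rewrite ltnS => tn sfg; have [xt|xt] := pselect (span (unzip1 t) x).
  have [c xE] := span_nth xt; rewrite size_map in xE.
  pose t' := [seq ((nth (0, 0) t i).1, (nth (0, 0) t i).2 + c i *: y) |
    i <- iota 0 (size t)].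
  (* Stated for a general balanced biadditive map, to serve both for the tensors and for the
     products [f u * g v]. *)
  have E (Z : zmodType) (G : X -> Y -> Z) :
      (forall u v w, G u (v + w) = G u v + G u w) ->
      (forall a u v, G u (a *: v) = G (a *: u) v) ->
      (forall u v w, G (u + v) w = G u w + G v w) ->
      \sum_(z <- (x, y) :: t) G z.1 z.2 = \sum_(z <- t') G z.1 z.2.
    move=> GDr GZ GDl; have G0 v : G 0 v = 0.
      by apply: (addrI (G 0 v)); rewrite -GDl !addr0.
    rewrite big_cons /t' big_map /= [in LHS](big_nth (0, 0)) /index_iota subn0.
    under [RHS]eq_bigr do rewrite GDr.
    rewrite big_split/= addrC; congr (_ + _).
    rewrite xE /index_iota subn0.
    rewrite (big_morph (fun u => G u y) (fun u v => GDl u v y) (G0 y)).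
    rewrite big_seq [RHS]big_seq; apply: eq_bigr => i; rewrite mem_iota add0n => it.
    by rewrite GZ (nth_map (0, 0)).
  rewrite (E _ (fun u v => u ⊗ v)); first last.
  - exact: elem_tensorDl.
  - by move=> a u v; rewrite elem_tensorZl elem_tensorZr.
  - exact: elem_tensorDr.
  apply: IH => [|f g]; first by rewrite size_map size_iota.
  rewrite -(E _ (fun u v => f u * g v : K)) ?sfg// => [u v w|a u v|u v w].
  - by rewrite linearD mulrDr.
  - by rewrite !linearZ_LR; exact: etrans (mulrCA (f u : K) a (g v)) (mulrA _ _ _).
  - by rewrite linearD mulrDl.
have [f [fx ft]] := span_separation xt.
have ft0 z : z \in t -> f z.1 = 0 by move=> zt; apply/ft/mem_span/map_f.
have y0 : y = 0.
  (* A nonzero [y] lies outside the span of the empty family, so some [g] has [g y = 1], and the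
     hypothesis on [f] and [g] would read [1 = 0]. *)
  apply: contrapT => y0; have [|g [gy _]] := @span_separation _ _ _ [::] y.
    by move=> [c]; rewrite big_ord0.
  have := sfg f g; rewrite big_cons big_seq big1 => [|z zt]; last first.
    by rewrite ft0// mul0r.
  by rewrite /= fx gy mulr1 addr0 => /eqP; rewrite oner_eq0.
have t0 (u : X) : u ⊗ (0 : Y) = 0.
  by rewrite -(scale0r (0 : Y)) elem_tensorZr scale0r.
rewrite big_cons /= y0 t0 add0r; apply: IH => // h g.
by have := sfg h g; rewrite big_cons /= y0 linear0 mulr0 add0r.
Qed.

Lemma injective_norm_definite (u : tensor X Y) :
  (injective_norm u <= 0)%E -> u = 0.
Proof.
have [s ->] := tensorP u => u0; apply: injective_separates => f g.
(* Dividing by [1 + |h|] instead of [|h|] reaches the unit ball without excluding [h = 0]. *)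
have Vn (Z : normedModType K) (h : dual Z) : nrm (scal_real k (1 + nrm h)^-1 *: h) <= 1.
  have h1 : 0 < 1 + nrm h by rewrite ltr_wpDr ?nrm_ge0.
  rewrite nrmZ nrm_scal_real ?invr_ge0 ?(ltW h1)// ler_pdivrMl// mulr1.
  by rewrite lerDr.
set a := scal_real k (1 + nrm f)^-1; set b := scal_real k (1 + nrm g)^-1.
have r0 (Z : normedModType K) (h : dual Z) : scal_real k (1 + nrm h)^-1 != 0.
  rewrite -(@scal_real0 R k) (inj_eq (@scal_real_inj R k)) invr_eq0.
  by rewrite gt_eqF// ltr_wpDr ?nrm_ge0.
have : (enrm (val (\sum_(z <- s) z.1 ⊗ z.2)%R
    (form_product (a *: f : dual X)%R (b *: g : dual Y)%R)) <= 0)%E.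
  apply: le_trans u0; apply: ereal_sup_ubound.
  by exists (a *: f), (b *: g); split => //; exact: Vn.
rewrite lee_fin => n0; have /nrm0_eq0 : nrm (val (\sum_(z <- s) z.1 ⊗ z.2)
    (form_product (a *: f : dual X) (b *: g : dual Y))) = 0.
  by apply/eqP; rewrite eq_le n0 nrm_ge0.
rewrite sum_elem_tensorE /formal_sum => e.
have : \sum_(z <- s) (a * b) * (f z.1 * g z.2 : K) = 0.
  by rewrite -[RHS]e; apply: eq_bigr => z _; rewrite mulrACA.
by rewrite -mulr_sumr => /eqP; rewrite !mulf_eq0 !(negbTE (r0 _ _)) => /eqP.
Qed.

End injective_definite.

(** * Merging functionals *)

Lemma powR_lipschitz_on (R : realType) (q B : R) : 1 <= q -> 0 < B ->
  exists2 L : R, 0 < L & forall s t, 0 <= s -> 0 <= t -> t <= B ->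
    t `^ q - s `^ q <= L * `|t - s|.
Proof.
move=> q1 B0; have [L L0 LP] := powR_lipschitz q1.
exists (B `^ q * L / B) => [|s t s0 t0 tB].
  by rewrite divr_gt0// mulr_gt0// powR_gt0.
have E (r : R) : 0 <= r -> r `^ q = B `^ q * (r / B) `^ q.
  move=> r0; rewrite -powRM ?divr_ge0 ?(ltW B0)//.
  by rewrite mulrCA divff ?mulr1// gt_eqF.
rewrite (E t)// (E s)// -mulrBr -!mulrA ler_wpM2l ?powR_ge0//.
have -> : B^-1 * `|t - s| = `|t / B - s / B|.
  by rewrite -mulrBl normrM (gtr0_norm (_ : 0 < B^-1)) ?invr_gt0// mulrC.
by apply: LP; rewrite ?divr_ge0 ?(ltW B0)// ler_pdivrMr// mul1r.
Qed.

(** Total boundedness of the unit ball of the scalars, from a grid on the real and imaginary parts;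
    cells outside the ball are arbitrary. *)
Lemma scalar_cells (R : realType) (k : scalar_kind) (d : R) : 0 < d ->
  exists (T : finType) (cell : scalar_field R k -> T),
    forall a b : (scalar_field R k)^o, nrm a <= 1 -> nrm b <= 1 ->
      cell a = cell b -> nrm (a - b) <= d.
Proof.
have real_cells (e : R) : 0 < e -> exists (N : nat) (c : R -> 'I_N.+1),
    forall x y, `|x| <= 1 -> `|y| <= 1 -> c x = c y -> `|x - y| <= e.
  move=> e0; pose N := Num.truncn (2 / e).
  exists N, (fun x => inord (Num.truncn ((x + 1) / e))).
  have tN x : `|x| <= 1 -> (Num.truncn ((x + 1) / e) <= N)%N.
    by rewrite ler_norml => /andP[x0 x1]; rewrite le_truncn// ler_pM2r ?invr_gt0//; lra.
  have tP x : `|x| <= 1 ->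
      (Num.truncn ((x + 1) / e))%:R * e <= x + 1 < (Num.truncn ((x + 1) / e)).+1%:R * e.
    rewrite ler_norml => /andP[x0 x1]; rewrite -ler_pdivlMr// -ltr_pdivrMr//.
    by rewrite truncn_itv// divr_ge0 ?(ltW e0)//; lra.
  move=> x y x1 y1 /(congr1 val); rewrite /= !inordK ?ltnS ?tN// => xy.
  have := tP x x1; have := tP y y1; rewrite -xy -natr1 mulrDl mul1r => /andP[? ?] /andP[? ?].
  by rewrite ler_norml; lra.
move=> d0; case: k => /=.
  have [N [c cP]] := real_cells d d0.
  by exists 'I_N.+1, c => a b a1 b1; exact: cP.
have [N [c cP]] := real_cells (d / 2) (divr_gt0 d0 (ltr0n _ 2)).
exists ('I_N.+1 * 'I_N.+1)%type, (fun z => (c (complex.Re z), c (complex.Im z))).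
move=> a b a1 b1 [cre cim]; rewrite (le_trans (nrm_complex_le _))// [d]splitr.
have le1 (z : (scalar_field R ComplexScalars)^o) : nrm z <= 1 ->
    `|complex.Re z| <= 1 /\ `|complex.Im z| <= 1.
  move=> z1; split; first exact: le_trans (norm_Re_le_nrm z) z1.
  exact: le_trans (norm_Im_le_nrm z) z1.
have [ra ia] := le1 _ a1; have [rb ib] := le1 _ b1.
apply: lerD.
  by apply: le_trans (cP _ _ ra rb cre); case: (a) (b) => [? ?] [? ?].
by apply: le_trans (cP _ _ ia ib cim); case: (a) (b) => [? ?] [? ?].
Qed.

Section clustering.
Context {R : realType} {k : scalar_kind}.
Local Notation K := (scalar_field R k).

Lemma ler_dist_nrm (V : normedModType K) (x y : V) :
  `|nrm x - nrm y| <= nrm (x - y).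
Proof.
rewrite ler_norml; apply/andP; split.
  by have := nrmD x (y - x); rewrite addrC subrK nrmB; lra.
by have := nrmD (x - y) y; rewrite subrK; lra.
Qed.

Variables (V : normedModType K) (q : R) (xs : seq V).
Hypothesis q1 : 1 <= q.
Let q0 : 0 < q := lt_le_trans ltr01 q1.

Definition mass (f : dual V) : R := \sum_(x <- xs) nrm (f x) `^ q.

(** The functional rescaled to mass 1 on [xs], and 0 if its mass is 0; positive multiples of a
    functional share a profile. *)
Definition profile (f : dual V) (x : V) : K^o :=
  scal_real k (mass f `^ q^-1)^-1 *: f x.

Lemma mass_ge0 f : 0 <= mass f.
Proof. by apply: sumr_ge0 => x _; exact: powR_ge0. Qed.

Lemma profile_powR f x : nrm (profile f x) `^ q = (mass f)^-1 * nrm (f x) `^ q.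
Proof.
rewrite nrmZ nrm_scal_real ?invr_ge0 ?powR_ge0// powRM ?invr_ge0 ?powR_ge0 ?nrm_ge0//.
congr (_ * _); rewrite -powRN -powRrM mulNr mulVf ?gt_eqF//.
by rewrite powR_inv1// mass_ge0.
Qed.

Lemma profile_le1 f x : 0 < mass f -> x \in xs -> nrm (profile f x) <= 1.
Proof.
move=> f0 xxs; apply: (powR_le_nneg q0); rewrite ?nrm_ge0//.
rewrite powR1 profile_powR ler_pdivrMl// mulr1 /mass (big_rem x)//= lerDl.
by apply: sumr_ge0 => y _; exact: powR_ge0.
Qed.

(* Functionals with almost the same profile on [xs] can be replaced by a single
   one without increasing the weak norm (Jensen) nor losing much mass on [xs]. *)
Lemma merge_functionals (d L : R) (l : seq (dual V)) :
  (forall s t : R, 0 <= s -> 0 <= t -> t <= 1 -> t `^ q - s `^ q <= L * `|t - s|) ->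
  0 <= L ->
  (forall f g x, f \in l -> g \in l -> x \in xs -> 0 < mass f -> 0 < mass g ->
    nrm (profile f x - profile g x) <= d) ->
  exists g : dual V,
    (forall x, nrm (g x) `^ q <= \sum_(f <- l) nrm (f x) `^ q) /\
    (1 - (size xs)%:R * (L * d)) * (\sum_(f <- l) mass f) <= mass g.
Proof.
move=> Lip L0 ld; set S := \sum_(f <- l) _.
have S0 : 0 <= S by apply: sumr_ge0 => f _; exact: mass_ge0.
have [SE|SN0] := eqVneq S 0.
  exists 0; rewrite SE mulr0 mass_ge0; split => // x.
  rewrite [X in nrm X](_ : _ = 0 :> K^o)// powR_nrm0 ?gt_eqF//.
  by apply: sumr_ge0 => f _; exact: powR_ge0.
have {}S0 : 0 < S by rewrite lt_neqAle eq_sym SN0.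
(* The merged [g] is [S ^ (1 / q)] times the mean of the rescaled functionals, weighted by mass.
   After Jensen's inequality the masses cancel, leaving at most the sum of the [|f x| ^ q]. *)
pose w f := mass f / S.
have w0 f : 0 <= w f by rewrite divr_ge0 ?mass_ge0 ?(ltW S0).
have w1 : \sum_(f <- l) w f = 1 by rewrite -mulr_suml divff.
pose h x : K^o := \sum_(f <- l) scal_real k (w f) *: profile f x.
pose g : dual V := scal_real k (S `^ q^-1) *:
  \sum_(f <- l) scal_real k (w f) *: (scal_real k (mass f `^ q^-1)^-1 *: f).
have gE x : nrm (g x) `^ q = S * nrm (h x) `^ q.
  have -> : g x = scal_real k (S `^ q^-1) *: h x.
    by rewrite [LHS](_ : _ = scal_real k (S `^ q^-1) *: ((\sum_(f <- l)
      scal_real k (w f) *: (scal_real k (mass f `^ q^-1)^-1 *: f) : dual V) x))// dual_sumE.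
  rewrite nrmZ nrm_scal_real ?powR_ge0// powRM ?powR_ge0 ?nrm_ge0//.
  by rewrite powRVK ?gt_eqF// ltW.
have hle x : nrm (h x) <= \sum_(f <- l) w f * nrm (profile f x).
  rewrite (le_trans (nrm_sum _ _ _))//; apply: ler_sum => f _.
  by rewrite nrmZ nrm_scal_real.
exists g; split=> [x|].
  rewrite gE; apply: (@le_trans _ _ (S * \sum_(f <- l) w f * nrm (profile f x) `^ q)).
    rewrite ler_wpM2l ?(ltW S0)//.
    apply: le_trans (powR_sum_le q1 w0 (fun f => nrm_ge0 (profile f x)) w1).
    by apply: ler_powR_nneg (hle x); rewrite ?nrm_ge0// ltW.
  rewrite mulr_sumr; apply: ler_sum => f _; rewrite profile_powR /w.
  have -> : S * (mass f / S * ((mass f)^-1 * nrm (f x) `^ q)) =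
      mass f / mass f * nrm (f x) `^ q by rewrite mulrCA !mulrA divfK.
  have [->|f0] := eqVneq (mass f) 0; first by rewrite mul0r mul0r powR_ge0.
  by rewrite divff// mul1r.
have [f0 f0l mf0] : exists2 f, f \in l & 0 < mass f.
  apply: contrapT => H; move: SN0; rewrite /S big_seq big1 ?eqxx// => f fl.
  apply/eqP; rewrite eq_le mass_ge0 andbT leNgt; apply/negP => mf.
  by apply: H; exists f.
(* All profiles of nonzero weight are within [d] of that of [f0], hence so is their mean [h]. The
   profile of [f0] has mass 1, and replacing it by [h] costs at most [L * d] at each point of
   [xs]. *)
have hd x : x \in xs -> nrm (profile f0 x - h x) <= d.
  move=> xxs; have -> : profile f0 x - h x =
      \sum_(f <- l) scal_real k (w f) *: (profile f0 x - profile f x).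
    under [RHS]eq_bigr do rewrite scalerBr.
    rewrite sumrB -scaler_suml -[in RHS]scal_real_sum w1 scal_real1 scale1r.
    by [].
  rewrite (le_trans (nrm_sum _ _ _))// -[d]mul1r -w1 mulr_suml.
  rewrite big_seq [leRHS]big_seq; apply: ler_sum => f fl.
  rewrite nrmZ nrm_scal_real//.
  have [mf|mf] := eqVneq (mass f) 0; first by rewrite /w mf !mul0r.
  by rewrite ler_wpM2l// ld// lt_neqAle eq_sym mf mass_ge0.
have prof1 : \sum_(x <- xs) nrm (profile f0 x) `^ q = 1.
  under eq_bigr do rewrite profile_powR.
  by rewrite -mulr_sumr mulVf// gt_eqF.
have -> : mass g = S * \sum_(x <- xs) nrm (h x) `^ q.
  by rewrite mulr_sumr; apply: eq_bigr => x _; exact: gE.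
rewrite mulrC ler_wpM2l ?(ltW S0)// lerBlDr -lerBlDl -[X in X - _]prof1 -sumrB.
have -> : (size xs)%:R * (L * d) = \sum_(x <- xs) L * d.
  by rewrite big_const_seq count_predT iter_addr_0 mulr_natl.
rewrite big_seq [leRHS]big_seq; apply: ler_sum => x xxs.
rewrite (le_trans (Lip _ _ (nrm_ge0 _) (nrm_ge0 _) (profile_le1 mf0 xxs)))//.
by rewrite ler_wpM2l// (le_trans (ler_dist_nrm _ _))// hd.
Qed.

End clustering.

Section uniform_length.
Context {R : realType} {k : scalar_kind}.
Local Notation K := (scalar_field R k).

(** One merged functional is kept for each assignment of cells to the [J] points; the number of
    assignments depends neither on [V] nor on [l]. *)
Lemma bounded_length_family (q : R) (J : nat) (D C : R) :
  1 <= q -> 0 <= D -> D < C ->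
  exists m : nat, forall (V : normedModType K) (xs : seq V) (l : seq (dual V)),
    size xs = J -> weak_le1 q l -> C < \sum_(f <- l) mass q xs f ->
    exists l' : seq (dual V),
      [/\ size l' = m, weak_le1 q l' & D <= \sum_(f <- l') mass q xs f].
Proof.
move=> q1 D0 DC; have C0 : 0 < C by exact: le_lt_trans DC.
have [L L0 Lip] := @powR_lipschitz R q q1.
have JL0 : 0 < J%:R * L + 1 by rewrite ltr_wpDl// mulr_ge0// ltW.
(* Chosen so that the fraction [J * L * d] of the mass lost in merging is at most [1 - D / C]; the
   summand 1 allows [J = 0]. *)
pose d := (1 - D / C) / (J%:R * L + 1).
have DC1 : 0 < 1 - D / C by rewrite subr_gt0 ltr_pdivrMr// mul1r.
have d0 : 0 < d by rewrite divr_gt0.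
have [T [cell cellP]] := @scalar_cells R k d d0.
exists #|{ffun 'I_J -> T}| => V xs l xsJ lq lC.
pose idx (f : dual V) := [ffun j : 'I_J => cell (profile q xs f (nth 0 xs j))].
pose lc i := [seq f <- l | idx f == i].
have near_profile i f g x : f \in lc i -> g \in lc i -> x \in xs ->
    0 < mass q xs f -> 0 < mass q xs g ->
    nrm (profile q xs f x - profile q xs g x) <= d.
  rewrite !mem_filter => /andP[/eqP fi _] /andP[/eqP gi _] xxs mf mg.
  apply: cellP; [exact: profile_le1|exact: profile_le1|].
  have xJ : (index x xs < J)%N by rewrite -xsJ index_mem.
  have /ffunP/(_ (Ordinal xJ)) : idx f = idx g by rewrite fi gi.
  by rewrite !ffunE /= nth_index.
have mg := fun i => merge_functionals q1 Lip (ltW L0) (@near_profile i).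
rewrite xsJ in mg.
have [g gP] := choice mg.
have gw i x : nrm (g i x) `^ q <= \sum_(f <- l | idx f == i) nrm (f x) `^ q.
  by rewrite -big_filter; exact: (gP i).1.
have gm i : (1 - J%:R * (L * d)) * (\sum_(f <- l | idx f == i) mass q xs f) <=
    mass q xs (g i).
  by have := (gP i).2; rewrite big_filter.
exists [seq g i | i <- enum {ffun 'I_J -> T}]; split.
- by rewrite size_map -cardE.
- move=> x; rewrite big_map big_enum/=; apply: le_trans (lq x).
  rewrite [leRHS](partition_big idx xpredT)//=.
  by apply: ler_sum => i _; exact: gw.
rewrite big_map big_enum/=.
apply: (@le_trans _ _ (\sum_i (1 - J%:R * (L * d)) *
    (\sum_(f <- l | idx f == i) mass q xs f))); last by apply: ler_sum => i _; exact: gm.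
rewrite -mulr_sumr.
have -> : \sum_i \sum_(f <- l | idx f == i) mass q xs f = \sum_(f <- l) mass q xs f.
  by rewrite [RHS](partition_big idx xpredT).
have dE : D / C <= 1 - J%:R * (L * d).
  have : d * (J%:R * L + 1) = 1 - D / C by rewrite divfK// gt_eqF.
  by lra.
rewrite -[leLHS](divfK (_ : C != 0)) ?gt_eqF//.
by apply: ler_pM => //; [rewrite divr_ge0// ltW|exact: ltW|exact: ltW].
Qed.

End uniform_length.

(** * Finite generation *)

Section compactness.
Context {R : realType} {k : scalar_kind}.
Local Notation K := (scalar_field R k).

Lemma ultra_scalar_limit (T : Type) (F : set_system T) (h : T -> K^o) (B : R) :
  UltraFilter F -> (forall t, nrm (h t) <= B) ->
  exists l : K^o, forall e : R, 0 < e -> F [set t | nrm (h t - l) <= e].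
Proof.
move=> FU.
have real_lim (g : T -> R) (C : R) : (forall t, `|g t| <= C) ->
    exists l : R, forall e : R, 0 < e -> F [set t | `|g t - l| <= e].
  (* The limit is the supremum of the numbers that bound [g] from below on a set of the
     ultrafilter. *)
  move=> gC; pose A := [set r | F [set t | r <= g t]].
  have AC : ubound A C.
    move=> r /filter_ex[t /le_trans]; apply.
    by have := gC t; rewrite ler_norml => /andP[].
  have A0 : A (- C).
    by apply: filterE => t; have := gC t; rewrite ler_norml => /andP[].
  have hA : has_sup A by split; [exists (- C)|exists C].
  exists (sup A) => e e0.
  have [r Ar re] := sup_adherent e0 hA.
  have [Ae|] := in_ultra_setVsetC [set t | sup A + e <= g t] FU.
    have : sup A + e <= sup A by apply: ub_le_sup; [exists C|].
    by rewrite gerDl leNgt e0.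
  apply: filterS2 Ar => t /= rg /negP; rewrite -ltNge => ge.
  by rewrite ler_norml; lra.
case: k h => h hB; first by have [l lP] := real_lim h B hB; exists l.
have [a aP] := real_lim (fun t => complex.Re (h t)) B
  (fun t => le_trans (norm_Re_le_nrm (h t)) (hB t)).
have [b bP] := real_lim (fun t => complex.Im (h t)) B
  (fun t => le_trans (norm_Im_le_nrm (h t)) (hB t)).
exists (Complex a b) => e e0.
have e20 : 0 < e / 2 by rewrite divr_gt0.
apply: filterS2 (aP _ e20) (bP _ e20) => t /= ta tb.
rewrite (le_trans (nrm_complex_le _))// [e]splitr.
by apply: lerD; [apply: le_trans ta|apply: le_trans tb]; case: (h t).
Qed.

End compactness.

Section fd_lift.
Context {R : realType} {k : scalar_kind}.
Local Notation K := (scalar_field R k).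
Variable X : completeNormedModType K.
Implicit Type M : fd_subspace X.

(* The junk value outside [M] is 0. *)
Definition fd_lift M (x : X) : fd_carrier M := insubd 0 x.

Lemma fd_liftK M x : fd_set M x -> fd_incl (fd_lift M x) = x.
Proof. by move=> Mx; rewrite /fd_incl /fd_lift insubdK//; exact/asboolP. Qed.

Lemma nrm_fd_lift M x : nrm (fd_lift M x) <= nrm x.
Proof.
have [Mx|Mx] := boolP (x \in fd_pred M).
  by rewrite [leLHS](_ : _ = nrm (fd_incl (fd_lift M x)))// fd_liftK//; exact/asboolP.
by rewrite /fd_lift /insubd insubN//= nrm0 nrm_ge0.
Qed.

Lemma fd_lift_linear M (a : K) x y : fd_set M x -> fd_set M y ->
  fd_lift M (a *: x + y) = a *: fd_lift M x + fd_lift M y.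
Proof.
move=> Mx My; apply: val_inj; rewrite -[LHS]/(fd_incl _) -[RHS]/(fd_incl _).
have Mxy : fd_set M (a *: x + y).
  by have [s sE] := fd_setP M; move: Mx My; rewrite sE; exact: span_lin.
rewrite (fd_liftK Mxy).
transitivity (a *: fd_incl (fd_lift M x) + fd_incl (fd_lift M y)); last by [].
by rewrite !fd_liftK.
Qed.

Definition fd_span (s : seq X) : fd_subspace X := FdSubspace (ex_intro _ s erefl).

(** The pointwise limits of the [i]-th functionals as [t] grows. The conclusion, a single [t] good
    for finitely many points and all [i < m], hides the ultrafilter. *)
Lemma ultra_dual_limit (m : nat) (xs : seq X)
    (l : forall t, seq (dual (fd_carrier (fd_span (xs ++ t))))) :
  (forall t (f : dual (fd_carrier (fd_span (xs ++ t)))) x,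
    f \in l t -> nrm (f x) <= nrm x) ->
  exists g : nat -> dual X, forall (ys : seq X) (e : R), 0 < e ->
    exists t, forall y i, y \in ys -> (i < m)%N ->
      nrm ((nth 0 (l t) i : dual _) (fd_lift _ y) - g i y) <= e.
Proof.
move=> lB.
(* The filter of inclusion: along it, any finitely many points eventually lie in the subspace, where
   lifting is linear. *)
pose up := [set A : set (seq X) | exists s : seq X, forall t, {subset s <= t} -> A t].
have upF : ProperFilter up.
  split; first by move=> [s /(_ s)]; exact.
  split; first by exists [::].
    move=> A B [s sA] [t tB]; exists (s ++ t) => r str; split.
      by apply: sA => x xs'; apply: str; rewrite mem_cat xs'.
    by apply: tB => x xt; apply: str; rewrite mem_cat xt orbT.
  by move=> A B AB [s sA]; exists s => t /sA /AB.
have [F [FU upleF]] := ultraFilterLemma upF.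
pose h i x t : K^o   := (nth 0 (l t) i : dual _) (fd_lift (fd_span (xs ++ t)) x).
have hB i x t : nrm (h i x t) <= nrm x.
  have [im|mi] := ltnP i (size (l t)).
    by rewrite (le_trans (lB t _ _ (mem_nth 0 im)))// nrm_fd_lift.
  rewrite /h nth_default// [X in nrm X](_ : _ = 0 :> K^o)//.
  by rewrite nrm0 nrm_ge0.
have lim i x := ultra_scalar_limit FU (hB i x).
pose G i := projT1 (choice (lim i)).
have GP i : forall x (e : R), 0 < e -> F [set t | nrm (h i x t - G i x) <= e] :=
  projT2 (choice (lim i)).
have Fin (s : seq X) : F [set t : seq X | {subset s <= t}] by apply: upleF; exists s.
have Glin i : linear (G i).
  move=> a x y; apply/eqP; rewrite -subr_eq0; apply/eqP/nrm0_eq0/eqP.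
  rewrite eq_le nrm_ge0 andbT; apply/ler_addgt0Pr => e e0; rewrite add0r.
  have c0 : 0 < nrm (a : K^o) + 2 by rewrite ltr_wpDl ?nrm_ge0.
  (* Three errors add up: [d], [|a| * d] and [d]. *)
  pose d := e / (nrm (a : K^o) + 2).
  have d0 : 0 < d by rewrite divr_gt0.
  have [t [[[/= t1 t2] t3] tin]] := filter_ex (filterI (filterI (filterI
    (GP i (a *: x + y) d d0) (GP i x d d0)) (GP i y d d0)) (Fin [:: x; y])).
  have hE : h i (a *: x + y) t = a *: h i x t + h i y t.
    rewrite /h fd_lift_linear ?linearP//; apply: mem_span; rewrite mem_cat;
      by rewrite tin ?orbT// !inE eqxx ?orbT.
  have -> : G i (a *: x + y) - (a *: G i x + G i y) =
      - (h i (a *: x + y) t - G i (a *: x + y)) + (a *: (h i x t - G i x) + (h i y t - G i y)).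
    by rewrite hE scalerBr opprB (addrACA (a *: h i x t)) -opprD addrA subrK.
  rewrite (le_trans (nrmD _ _))// nrmN (le_trans (lerD t1 (nrmD _ _)))// nrmZ.
  have -> : e = d + (nrm (a : K^o) * d + d) by rewrite /d; field; rewrite gt_eqF.
  by rewrite lerD2l lerD// ler_wpM2l// nrm_ge0.
have GB i x : nrm (G i x) <= 1 * nrm x.
  rewrite mul1r; apply/ler_addgt0Pr => e e0.
  have [t /= te] := filter_ex (GP i x e e0).
  have := nrmD (h i x t) (G i x - h i x t); rewrite addrC subrK nrmB.
  by have := hB i x t; lra.
have [g gE] := choice (fun i => dual_of_bounded (Glin i) (GB i)).
exists g => ys e e0.
suff : F [set t | forall y i, y \in ys -> (i < m)%N -> nrm (h i y t - G i y) <= e].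
  move=> /filter_ex[t /= tP]; exists t => y i yys im; rewrite gE; exact: tP.
elim: ys => [|y ys IH]; first by apply: filterE.
have Fy : F [set t | forall i : 'I_m, nrm (h i y t - G i y) <= e].
  by apply: (@filter_forall _ _ (fun (i : 'I_m) t => nrm (h i y t - G i y) <= e)) => i;
    exact: GP.
apply: filterS2 Fy IH => t /= ty tys z i; rewrite inE => /predU1P[->|zys] im.
  exact: (ty (Ordinal im)).
exact: tys.
Qed.

End fd_lift.

(** * Mid norms in finite-dimensional subspaces *)

Section mid_le_fd_subspace.
Context {R : realType} {k : scalar_kind}.
Local Notation K := (scalar_field R k).
Variable X : completeNormedModType K.

Lemma weak_le1_mem (V : normedModType K) (q : R) (l : seq (dual V)) (f : dual V) x :
  0 < q -> weak_le1 q l -> f \in l -> nrm (f x) <= nrm x.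
Proof.
move=> q0 lq fl; apply: (powR_le_nneg q0); rewrite ?nrm_ge0//.
apply: le_trans (lq x); rewrite (big_rem f)//= lerDl.
by apply: sumr_ge0 => g _; exact: powR_ge0.
Qed.

(** With the length fixed at [m], the weak bound and the mass are sums of a fixed number of terms,
    so both pass to the pointwise limit. *)
Lemma weak_family_limit (m : nat) (q D : R) (xs : seq X) : 1 <= q ->
  (forall t, exists l : seq (dual (fd_carrier (fd_span (xs ++ t)))),
    [/\ size l = m, weak_le1 q l &
      D <= \sum_(f <- l) mass q (map (fd_lift _) xs) f]) ->
  exists2 l : seq (dual X), weak_le1 q l & D <= \sum_(f <- l) mass q xs f.
Proof.
move=> q1 H; have q0 : 0 < q by lra.
pose l t := projT1 (cid (H t)).
have lm t : size (l t) = m by case: (projT2 (cid (H t))).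
have lq t : weak_le1 q (l t) by case: (projT2 (cid (H t))).
have lD t : D <= \sum_(f <- l t) mass q (map (fd_lift _) xs) f.
  by case: (projT2 (cid (H t))).
have [g gP] := @ultra_dual_limit R k X m xs l
  (fun t f x => @weak_le1_mem _ q (l t) f x q0 (lq t)).
pose h t i x : K^o := (nth 0 (l t) i : dual _) (fd_lift (fd_span (xs ++ t)) x).
have hx t i x : (i < m)%N -> nrm (h t i x) <= nrm x.
  move=> im; apply: le_trans (nrm_fd_lift (fd_span (xs ++ t)) x).
  by apply: weak_le1_mem q0 (lq t) _; rewrite mem_nth// lm.
have gx i x : (i < m)%N -> nrm (g i x) <= nrm x.
  move=> im; apply/ler_addgt0Pr => e e0.
  have [t /(_ x i (mem_head _ _) im) te] := gP [:: x] e e0.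
  have := nrmD (h t i x) (g i x - h t i x); rewrite addrC subrK [in X in _ -> X]addrC.
  by rewrite nrmB; have := hx t i x im; rewrite /h; lra.
(* All values in play are bounded by [B], and the [q]-th power is Lipschitz on the interval from 0
   to [B]. *)
have approx (ys : seq X) (e : R) : 0 < e -> exists t, forall y i, y \in ys -> (i < m)%N ->
    `|nrm (h t i y) `^ q - nrm (g i y) `^ q| <= e.
  move=> e0; pose B := \sum_(y <- ys) nrm y + 1.
  have B0 : 0 < B by rewrite ltr_wpDl// sumr_ge0// => y _; exact: nrm_ge0.
  have yB y : y \in ys -> nrm y <= B.
    move=> yys; rewrite /B (big_rem y)//= -addrA lerDl addr_ge0//.
    by apply: sumr_ge0 => z _; exact: nrm_ge0.
  have [L L0 Lip] := powR_lipschitz_on q1 B0.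
  have [t tP] := gP ys (e / L) (divr_gt0 e0 L0).
  exists t => y i yys im; have := tP y i yys im; rewrite -/(h t i y) => hg.
  have {}hg : L * `|nrm (h t i y) - nrm (g i y)| <= e.
    rewrite mulrC -ler_pdivlMr//; exact: le_trans (ler_dist_nrm _ _) hg.
  rewrite ler_norml lerNl opprB; apply/andP; split.
    rewrite (le_trans (Lip _ _ (nrm_ge0 _) (nrm_ge0 _) (le_trans (gx i y im) (yB y yys))))//.
    by rewrite distrC.
  by rewrite (le_trans (Lip _ _ (nrm_ge0 _) (nrm_ge0 _) (le_trans (hx t i y im) (yB y yys)))).
have sumE (W : normedModType K) (s : seq (dual W)) (F : dual W -> R) : size s = m ->
    \sum_(f <- s) F f = \sum_(i < m) F (nth 0 s i).
  by move=> sm; rewrite (big_nth 0) big_mkord sm.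
exists (mkseq g m) => [x|].
  rewrite sumE ?size_mkseq//; under eq_bigr do rewrite nth_mkseq//.
  apply/ler_addgt0Pr => e e0.
  have m1 : 0 < m%:R + 1 :> R by rewrite ltr_wpDl.
  have [t tP] := approx [:: x] (e / (m%:R + 1)) (divr_gt0 e0 m1).
  apply: (@le_trans _ _ (\sum_(i < m) (nrm (h t i x) `^ q + e / (m%:R + 1)))).
    apply: ler_sum => i _; have := tP x i (mem_head _ _) (ltn_ord i).
    by rewrite ler_norml => /andP[]; lra.
  rewrite big_split/= -(sumE _ (l t) (fun f : dual _ => nrm (f (fd_lift _ x)) `^ q))//.
  rewrite sumr_const card_ord -[X in _ + X <= _]mulr_natl; apply: lerD.
    rewrite (le_trans (lq t _))//; apply: ler_powR_nneg; rewrite ?nrm_ge0 ?(ltW q0)//.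
    exact: nrm_fd_lift.
  by rewrite mulrCA ler_piMr ?(ltW e0)// ler_pdivrMr//; lra.
rewrite sumE ?size_mkseq//; under eq_bigr do rewrite nth_mkseq//.
apply/ler_addgt0Pr => e e0.
pose d := m%:R * (size xs)%:R + 1 : R.
have d0 : 0 < d by rewrite ltr_wpDl// mulr_ge0.
have [t tP] := approx xs (e / d) (divr_gt0 e0 d0).
apply: (le_trans (lD t)); rewrite sumE//.
apply: (@le_trans _ _ (\sum_(i < m) (mass q xs (g i) + (size xs)%:R * (e / d)))).
  apply: ler_sum => i _; rewrite /mass big_map.
  have -> : (size xs)%:R * (e / d) = \sum_(x <- xs) e / d.
    by rewrite big_const_seq count_predT iter_addr_0 mulr_natl.
  rewrite -big_split/= big_seq [leRHS]big_seq; apply: ler_sum => x xxs.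
  have := tP x i xxs (ltn_ord i); rewrite ler_norml /h => /andP[]; lra.
rewrite big_split/= sumr_const card_ord -[X in _ + X <= _]mulr_natl lerD2l.
have -> : m%:R * ((size xs)%:R * (e / d)) = m%:R * (size xs)%:R * e / d.
  by rewrite !mulrA.
by rewrite ler_pdivrMr// /d; lra.
Qed.

(** If every subspace failed, each would carry a weakly bounded family of mass above [m' ^ q];
    shortened to a common length and passed to the limit, these would contradict the bound [m] on
    [X]. *)
Lemma mid_le_fd_subspace (q : \bar R) (xs : seq X) (m m' : R) :
  (1 <= q)%E -> 0 <= m -> m < m' -> mid_le q xs m ->
  exists M : fd_subspace X, (forall x, x \in xs -> fd_set M x) /\
    mid_le q (map (fd_lift M) xs) m'.
Proof.
case: q => [q|_ m0 mm' xsm|//]; last first.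
  exists (fd_span xs); split=> [x|_ /mapP[x xxs ->]]; first exact: mem_span.
  by rewrite (le_trans (nrm_fd_lift _ _))// (le_trans (xsm x xxs))// ltW.
rewrite lee_fin => q1 m0 mm' xsm; have q0 : 0 < q by lra.
apply: contrapT => H.
have m'0 : 0 <= m' by rewrite (le_trans m0)// ltW.
(* The gap between [c] and [m'] pays for the merging, that between [m] and [c] makes the
   contradiction strict. *)
pose c := (m + m') / 2.
have c0 : 0 <= c by rewrite divr_ge0// addr_ge0.
have mD : m `^ q < c `^ q by rewrite gt0_ltr_powR ?nnegrE// /c; lra.
have DC : c `^ q < m' `^ q by rewrite gt0_ltr_powR ?nnegrE// /c; lra.
have [n nP] := @bounded_length_family R k q (size xs) _ _ q1 (powR_ge0 c q) DC.
have [t|l lq] := @weak_family_limit n q (c `^ q) xs q1.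
  have [l lq lC] : exists2 l : seq (dual (fd_carrier (fd_span (xs ++ t)))),
      weak_le1 q l & m' `^ q < \sum_(f <- l) mass q (map (fd_lift _) xs) f.
    apply: contrapT => H'; apply: H; exists (fd_span (xs ++ t)); split=> [x xxs|l lq].
      by apply: mem_span; rewrite mem_cat xxs.
    by rewrite leNgt; apply/negP => lC; apply: H'; exists l.
  by apply: nP lq lC; rewrite size_map.
by move=> /(lt_le_trans mD); rewrite ltNge (xsm l lq).
Qed.

End mid_le_fd_subspace.

(** * Uniformity and finite generation of [gamma] *)

Section tensor_norm.
Context {R : realType} {k : scalar_kind}.
Local Notation K := (scalar_field R k).
Local Notation banach := (completeNormedModType K).
Variables (p : \bar R) (p1 : (1 <= p)%E).
Local Notation q := (hoelder_conjugate p).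
Let q1 : (1 <= q)%E := hoelder_conjugate_ge1 p1.

Lemma opnorm_bound (V W : normedModType K) (S : {linear V -> W}) : continuous S ->
  exists a : R, [/\ opnorm (@enrm R k V) (@enrm R k W) S = a%:E, 0 <= a &
    forall x, nrm (S x) <= a * nrm x].
Proof.
move=> /linear_bounded_continuous/linear_boundedP/pinfty_ex_gt0[r r0 Sr].
have r0' := ltW r0.
have Sr' x : nrm (S x) <= scal_re r * nrm x.
  by rewrite -(@le_scal_real R k) scal_realM scal_reK// !nrmE; exact: Sr.
have sr0 : 0 <= scal_re r by rewrite -(@le_scal_real R k) scal_real0 scal_reK.
have ub : (opnorm (@enrm R k V) (@enrm R k W) S <= (scal_re r)%:E)%E.
  apply: ge_ereal_sup => _ [x /= x1 <-]; rewrite lee_fin (le_trans (Sr' x))//.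
  by rewrite ler_piMr.
have lb x : nrm x <= 1 -> ((nrm (S x))%:E <= opnorm (@enrm R k V) (@enrm R k W) S)%E.
  by move=> x1; apply: ereal_sup_ubound; exists x.
have := lb 0; rewrite linear0 !nrm0 => /(_ ler01).
case E : (opnorm _ _ _) ub lb => [a||]// _ lb; rewrite lee_fin => a0.
exists a; split => // x; have [->|x0] := eqVneq x 0.
  by rewrite linear0 !nrm0 mulr0.
have nx0 : nrm x != 0 by apply: contra_neq x0; exact: nrm0_eq0.
have nx : 0 < nrm x by rewrite lt_neqAle eq_sym nx0 nrm_ge0.
have := lb (scal_real k (nrm x)^-1 *: x).
rewrite linearZ_LR !nrmZ nrm_scal_real ?invr_ge0 ?nrm_ge0// mulVf//.
by move=> /(_ (lexx _)); rewrite lee_fin ler_pdivrMl// mulrC.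
Qed.

Lemma gamma_tensor_norm : tensor_norm (@gamma R k p).
Proof.
split=> [X Y|X1 X2 Y1 Y2 S1 S2 S1c S2c].
  split=> [|u]; last by rewrite injective_le_gamma// gamma_le_projective.
  split.
  - by move=> u; rewrite gamma_ge0//=; have [a ->] := gamma_fin p1 u; rewrite ltry.
  - move=> u u0; apply: injective_norm_definite; rewrite -u0.
    exact: injective_le_gamma.
  - exact: gammaZ.
  - exact: gammaD.
have [a [-> a0 Sa]] := opnorm_bound S1c; have [b [-> b0 Sb]] := opnorm_bound S2c.
apply: ge_ereal_sup => _ [u /= u1 <-].
rewrite (le_trans (gamma_map p1 u a0 b0 Sa Sb))// -EFinM.
by rewrite -[leRHS]mule1 lee_pmul// ?gamma_ge0// lee_fin mulr_ge0.
Qed.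

Lemma gamma_finitely_generated : finitely_generated (@gamma R k p).
Proof.
move=> X Y u; apply/eqP; rewrite eq_le; apply/andP; split.
  (* The inclusions of subspaces are contractions, so mapping into [X] and [Y] does not increase
     [gamma]. *)
  apply: le_ereal_inf_tmp => _ [M [N [v [<- ->]]]].
  rewrite -[leRHS]mul1e -[1%E]/(1%:E) -[X in (X%:E * _)%E]mulr1.
  by apply: gamma_map => // x; rewrite mul1r.
apply: le_gamma => // s m c us m0 c0 sm sc.
apply/lee_addgt0Pr => e e0.
have c1 : 0 < c + 1 by rewrite ltr_wpDl.
(* The increase of the mid bound is later multiplied by [c], which gives at most [e]; the summand 1
   covers [c = 0]. *)
have md : m < m + e / (c + 1) by rewrite ltrDl divr_gt0.
have [M [Ms sM]] := mid_le_fd_subspace q1 m0 md sm.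
pose N := fd_span (unzip2 s).
pose s' := [seq (fd_lift M z.1, fd_lift N z.2) | z <- s].
apply: (@le_trans _ _ (@gamma R k p (fd_carrier M) (fd_carrier N)
    (\sum_(z <- s') z.1 ⊗ z.2)%R)).
  apply: ereal_inf_lbound; exists M, N, (\sum_(z <- s') z.1 ⊗ z.2); split => //.
  rewrite us linear_sum big_map big_seq [RHS]big_seq; apply: eq_bigr => z zs.
  transitivity (fd_incl (fd_lift M z.1) ⊗ fd_incl (fd_lift N z.2)).
    exact: val_inj.
  by rewrite !fd_liftK//; [apply/mem_span/map_f|exact/Ms/map_f].
apply: (@le_trans _ _ ((m + e / (c + 1)) * c)%:E).
  apply: gamma_le => //; first by rewrite addr_ge0// divr_ge0// ltW.
    by rewrite /s' /unzip1 -map_comp (map_comp (fd_lift M) fst).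
  rewrite -[c]mul1r /s' /unzip2 -map_comp (map_comp (fd_lift N) snd).
  by apply: strong_le_map => // y; rewrite mul1r nrm_fd_lift.
rewrite -EFinD lee_fin mulrDl lerD2l mulrAC ler_pdivrMr//.
by rewrite ler_wpM2l ?(ltW e0)//; lra.
Qed.

End tensor_norm.

Theorem theorem3p2 (R : realType) (k : scalar_kind) (p : \bar R)
    (hp : (1 <= p)%E) :
  tensor_norm (@gamma R k p) /\ finitely_generated (@gamma R k p).
Proof. by split; [exact: gamma_tensor_norm|exact: gamma_finitely_generated]. Qed.
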